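(* Let $p\in[1,2]$ and let $B^{l^p(3)}_1$ be the closed unit ball of $\mathbb{R}^3$ for the $l^p$ norm, with the $l^p$ metric. Then for every $\varepsilon>0$, \[ \mathrm{wdim}_\varepsilon B^{l^p(3)}_1=\begin{cases}0&\text{if }2\le\varepsilon,\\2&\text{if }2(\tfrac23)^{1/p}\le\varepsilon<2,\\3&\text{if }\varepsilon<2(\tfrac23)^{1/p}.\end{cases} \]
   Context: For a metric space $(X,d)$ and $\varepsilon>0$, an $\varepsilon$-embedding is a continuous map $f:X\to Y$ such that $\mathrm{Diam} f^{-1}(y)\le\varepsilon$ for all $y\in Y$. $\mathrm{wdim}_\varepsilon X$ is the smallest integer $k$ such that there exists an $\varepsilon$-embedding of $X$ into a $k$-dimensional polyhedron. *)

(* Defs.v *)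
From HB Require Import structures.
From mathcomp Require Import all_boot all_order all_algebra finmap.
From mathcomp Require Import all_classical all_reals all_analysis.
Set Implicit Arguments.
Unset Strict Implicit.
Unset Printing Implicit Defensive.
Import Order.TTheory GRing.Theory Num.Theory.
Import numFieldNormedType.Exports.
Local Open Scope classical_set_scope.
Local Open Scope ring_scope.

Section subspace_metric.
Context {R : realType} {X : metricType R} (A : set X).

Let dist (x y : A) : R := mdist (set_val x) (set_val y).

Let dist_ge0 x y : 0 <= dist x y. Proof. exact: mdist_ge0. Qed.

Let dist_positivity x y : dist x y = 0 -> x = y.
Proof. by move=> /mdist_positivity; exact: val_inj. Qed.

Let ballEdist (x : A) d : ball x d = [set y | dist x y < d].
Proof.
rewrite /dist.
have -> : ball x d = set_val @^-1` (ball (set_val x) d) by [].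
by rewrite ballEmdist.
Qed.

HB.instance Definition _ := PseudoMetric_isMetric.Build R (set_type A)
  dist_ge0 dist_positivity ballEdist.
End subspace_metric.

Section lp_norm.
Context {R : realType} (p : R) (n : nat).
Implicit Types x y : 'rV[R]_n.

Definition lp_norm x : R := (\sum_(i < n) `|x 0 i| `^ p) `^ p^-1.

Lemma lp_norm_ge0 x : 0 <= lp_norm x. Proof. exact: powR_ge0. Qed.

Hypothesis p1 : 1 <= p.

Let p_gt0 : 0 < p. Proof. exact: lt_le_trans p1. Qed.

Let sum_ge0 x : 0 <= \sum_(i < n) `|x 0 i| `^ p.
Proof. by apply: sumr_ge0 => i _; exact: powR_ge0. Qed.

Lemma lp_normK x : lp_norm x `^ p = \sum_(i < n) `|x 0 i| `^ p.
Proof. by rewrite -powRrM mulVf ?gt_eqF// powRr1. Qed.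

Lemma lp_norm0 : lp_norm 0 = 0.
Proof.
rewrite /lp_norm big1 ?powR0 ?invr_eq0 ?gt_eqF// => i _.
by rewrite mxE normr0 powR0 ?gt_eqF.
Qed.

Lemma lp_norm_eq0 x : lp_norm x = 0 -> x = 0.
Proof.
move=> x0; have := lp_normK x; rewrite x0 powR0 ?gt_eqF// => /esym/eqP.
rewrite psumr_eq0 => [/allP h|i _]; last exact: powR_ge0.
apply/rowP => i; rewrite mxE; apply/eqP; rewrite -normr_eq0.
have /implyP/(_ isT) := h i (mem_index_enum _).
by rewrite powR_eq0 => /andP[].
Qed.

Lemma lp_normN x : lp_norm (- x) = lp_norm x.
Proof. by congr (_ `^ _); apply: eq_bigr => i _; rewrite mxE normrN. Qed.

Lemma ler_lp_normD x y : lp_norm (x + y) <= lp_norm x + lp_norm y.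
Proof.
have [/eqP/lp_norm_eq0->|x0] := boolP (lp_norm x == 0).
  by rewrite lp_norm0 !add0r.
have [/eqP/lp_norm_eq0->|y0] := boolP (lp_norm y == 0).
  by rewrite lp_norm0 !addr0.
have sum1 z : lp_norm z != 0 ->
    \sum_(i < n) (`|z 0 i| / lp_norm z) `^ p = 1.
  move=> z0; under eq_bigr do rewrite powRM ?invr_ge0 ?lp_norm_ge0//.
  rewrite -big_distrl/= -lp_normK -powRM ?invr_ge0 ?lp_norm_ge0//.
  by rewrite mulfV// powR1.
have a0 : 0 < lp_norm x by rewrite lt_neqAle eq_sym x0 lp_norm_ge0.
have b0 : 0 < lp_norm y by rewrite lt_neqAle eq_sym y0 lp_norm_ge0.
have sx := sum1 _ x0; have sy := sum1 _ y0.
rewrite {1}/lp_norm; move: (lp_norm x) (lp_norm y) => a b in a0 b0 sx sy x0 y0 *.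
have ab0 : 0 < a + b by exact: addr_gt0.
have t0 : 0 <= a / (a + b) by rewrite divr_ge0// ltW.
have t1 : a / (a + b) <= 1 by rewrite ler_pdivrMr// mul1r lerDl ltW.
have tE : 1 - a / (a + b) = b / (a + b).
  by rewrite -{1}(divff (lt0r_neq0 ab0)) -mulrBl addrAC subrr add0r.
suff le_sum : \sum_(i < n) `|(x + y) 0 i| `^ p <= (a + b) `^ p.
  have -> : a + b = ((a + b) `^ p) `^ p^-1.
    by rewrite -powRrM mulfV ?gt_eqF// powRr1// ltW.
  by rewrite ge0_ler_powR ?nnegrE ?powR_ge0 ?sum_ge0// invr_ge0 ltW.
apply: (@le_trans _ _ (\sum_(i < n) (a + b) `^ p *
   (a / (a + b) * (`|x 0 i| / a) `^ p + b / (a + b) * (`|y 0 i| / b) `^ p))).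
  apply: ler_sum => i _.
  have h : (a / (a + b) * (`|x 0 i| / a) + b / (a + b) * (`|y 0 i| / b)) `^ p
      <= a / (a + b) * (`|x 0 i| / a) `^ p + b / (a + b) * (`|y 0 i| / b) `^ p.
    rewrite -tE; apply: (convex_powR p1 (Itv01 t0 t1));
    by rewrite inE/= in_itv/= andbT divr_ge0// ltW.
  apply: le_trans (ler_wpM2l (powR_ge0 _ _) h).
  rewrite -powRM ?(ltW ab0)//; last first.
    by rewrite addr_ge0// mulr_ge0 ?divr_ge0// ltW.
  apply: ge0_ler_powR; rewrite ?(ltW p_gt0) ?nnegrE//.
    by rewrite mulr_ge0 ?(ltW ab0)// addr_ge0// mulr_ge0 ?divr_ge0// ltW.
  rewrite mxE (le_trans (ler_normD _ _))// mulrDr.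
  suff cancel_ab c z : c != 0 -> (a + b) * (c / (a + b) * (z / c)) = z.
    by rewrite !cancel_ab.
  move=> c0; rewrite [c / _]mulrC -!mulrA mulVKf ?gt_eqF//.
  by rewrite mulrCA mulfV// mulr1.
rewrite -big_distrr/= -[leRHS]mulr1 ler_wpM2l ?powR_ge0//.
rewrite big_split/= -!big_distrr/=.
by rewrite sx sy !mulr1 -mulrDl mulfV// gt_eqF.
Qed.

End lp_norm.

(* The proof of [1 <= p] is a parameter of the type because [lp_norm p] is a
   norm only in that case. *)
Definition lp_space {R : realType} {p : R} (p1 : 1 <= p) (n : nat) : Type :=
  'rV[R]_n.

Section lp_space.
Context {R : realType} {p : R} (p1 : 1 <= p) (n : nat).
Local Notation X := (lp_space p1 n).

Let dist (x y : X) : R := lp_norm p (x - y : 'rV[R]_n).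

Let distxx x : dist x x = 0. Proof. by rewrite /dist subrr lp_norm0. Qed.

Let dist_positivity x y : dist x y = 0 -> x = y.
Proof. by move=> /(lp_norm_eq0 p1)/eqP; rewrite subr_eq0 => /eqP. Qed.

Let dist_sym x y : dist x y = dist y x.
Proof. by rewrite /dist -opprB lp_normN. Qed.

Let dist_triangle y x z : dist x z <= dist x y + dist y z.
Proof.
rewrite /dist; have -> : (x - z : 'rV[R]_n) = (x - y) + (y - z).
  by rewrite addrA subrK.
exact: ler_lp_normD.
Qed.

HB.instance Definition _ := Choice.copy X 'rV[R]_n.
HB.instance Definition _ := isMetric.Build R X
  distxx dist_positivity dist_sym dist_triangle.

Definition lp_unit_ball : set X := [set x | lp_norm p (x : 'rV[R]_n) <= 1].

End lp_space.

Arguments lp_unit_ball {R p} p1 n.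

(* Abstract simplicial complexes; they may be infinite, and elements of [V]
   that belong to no simplex are not vertices. *)
Record simplicial_complex (V : choiceType) := SimplicialComplex {
  simplices : set {fset V} ;
  simplices_neq0 : forall s, simplices s -> s != fset0 ;
  simplices_down : forall s t : {fset V},
    simplices s -> t != fset0 -> (t `<=` s)%fset -> simplices t }.

Definition has_dimension (V : choiceType) (K : simplicial_complex V) (k : nat) :=
  (forall s, simplices K s -> (#|` s| <= k.+1)%N) /\
  (exists2 s, simplices K s & #|` s| = k.+1).

Section polyhedron.
Context (R : realType) (V : choiceType).

(* barycentric coordinates *)
Definition closed_simplex (s : {fset V}) : set {ptws V -> R} :=
  [set x | [/\ forall v, 0 <= x v,
               forall v, v \notin s -> x v = 0 &
               \sum_(v <- s) x v = 1]].

Definition polyhedron (K : simplicial_complex V) : Type :=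
  set_type (\bigcup_(s in simplices K) closed_simplex s).

Variable K : simplicial_complex V.

Let face (s : {fset V}) : set (polyhedron K) :=
  [set x | closed_simplex s (set_val x)].

(* Weak topology: a set is open iff its trace on every closed simplex is
   relatively open. On a single simplex the pointwise topology is the
   Euclidean one. *)
Definition polyhedron_open (U : set (polyhedron K)) : Prop :=
  forall s, simplices K s -> exists2 W : set {ptws V -> R},
    open W & face s `&` U = face s `&` set_val @^-1` W.

Let openT_subproof : polyhedron_open setT.
Proof. by move=> s _; exists setT; [exact: openT|rewrite preimage_setT]. Qed.

Let openI_subproof : setI_closed polyhedron_open.
Proof.
move=> A B oA oB s Ks; have [A' oA' AA] := oA _ Ks; have [B' oB' BB] := oB _ Ks.
exists (A' `&` B'); first exact: openI.
by rewrite setIIr AA BB -setIIr preimage_setI.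
Qed.

Let open_bigU_subproof (I : Type) (f : I -> set (polyhedron K)) :
  (forall i, polyhedron_open (f i)) -> polyhedron_open (\bigcup_i f i).
Proof.
move=> of_ s Ks.
have /choice[W hW] : forall i, exists W : set {ptws V -> R},
    open W /\ face s `&` f i = face s `&` set_val @^-1` W.
  by move=> i; have [W ? ?] := of_ i _ Ks; exists W.
exists (\bigcup_i W i); first by apply: bigcup_open => i _; exact: (hW i).1.
rewrite preimage_bigcup !setI_bigcupr.
by apply: eq_bigcupr => i _; exact: (hW i).2.
Qed.

HB.instance Definition _ := Choice.on (polyhedron K).
HB.instance Definition _ := isOpenTopological.Build (polyhedron K)
  openT_subproof openI_subproof open_bigU_subproof.

End polyhedron.

Section width_dimension.
Context {R : realType}.

Definition diameter {X : metricType R} (A : set X) : \bar R :=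
  ereal_sup [set z | exists x y, [/\ A x, A y & z = (mdist x y)%:E]].

(* Empty fibres have diameter [-oo], so they impose no condition. *)
Definition epsilon_embedding {X : metricType R} {Y : topologicalType}
    (eps : R) (f : X -> Y) :=
  continuous f /\ forall y, (diameter (f @^-1` [set y]) <= eps%:E)%E.

Definition embeds_in_dimension (eps : R) (X : metricType R) (k : nat) :=
  exists (V : choiceType) (K : simplicial_complex V),
    has_dimension K k /\
    exists f : X -> polyhedron R K, epsilon_embedding eps f.

Definition is_wdim (eps : R) (X : metricType R) (k : nat) :=
  embeds_in_dimension eps X k /\
  forall j, embeds_in_dimension eps X j -> (k <= j)%N.

End width_dimension.

(* Main.v *)
(** Upper bounds: the ball sits in a 3-simplex; for the middle range, let
    v_1, ..., v_4 be the vertices of the tetrahedron inscribed in the cube and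
    slide every point of the ball in the direction of the vertex least aligned
    with it, opposite to it, until it lies on a cone over an edge.  The fibres
    are at most tripods with legs along the -v_i, and since a point y - s v_i of
    the ball has 3 s^p <= 1, their diameter is at most that of the tetrahedron,
    2 (2/3)^(1/p).

    No map to a graph for eps < 2: if no antipodal points of the sphere had equal
    images, take a fine triangulation and split it into the connected pieces on
    which the discretized map is constant.  Every piece P avoids -P, so -P lies
    in one component D(P) of the complement of P.  As H^1(S^2; Z/2) = 0, the
    boundary of D(P) lies in a single piece P', and D(P') is strictly smaller
    than D(P), so that a minimal D(P) cannot exist.

    No map f to a 2-complex for eps < 2 (2/3)^(1/p): average a finite net of the
    sphere with weights that are Lipschitz functions of f(x).  For x on the
    sphere the average is never a nonpositive multiple of x, by the bound
    |a - b|^p >= 2^(p-2) (a - b) (g(a) - g(b)), g = sgn |.|^(p-1), summed over a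
    convex combination of at most four points of the sphere that vanishes.  Hence
    by Poincare-Miranda the averages fill a neighbourhood of 0 in R^3, whereas a
    Lipschitz image of a finite 2-complex cannot. *)
Require Import Defs.
From mathcomp Require Import all_boot all_order all_algebra finmap.
From mathcomp Require Import all_classical all_reals all_analysis.
From mathcomp Require Import zify ring lra.
Set Implicit Arguments.
Unset Strict Implicit.
Unset Printing Implicit Defensive.
Import Order.TTheory GRing.Theory Num.Theory.
Import numFieldNormedType.Exports.

(** * Labellings of a triangulated sphere *)

(** A mod 2 simplicial 1-cocycle on the clique complex of [e], whose 2-simplices are the triples of
    pairwise related points. *)
Definition cocycle (X : finType) (e : rel X) (a : X -> X -> bool) :=
  (forall x y, a x y = a y x) /\
  (forall x y z, e x y -> e y z -> e x z -> a x z = a x y (+) a y z).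

Definition trivial_H1 (X : finType) (e : rel X) :=
  forall a, cocycle e a -> exists c : X -> bool, forall x y, e x y -> a x y = c x (+) c y.

Lemma connect_ind (X : finType) (e : rel X) (P : X -> Prop) x y :
  connect e x y -> P x -> (forall u v, connect e x u -> P u -> e u v -> P v) -> P y.
Proof.
move=> /connectP[s + ->] Px Pe.
elim/last_ind: s => [//|s z IH]; rewrite rcons_path last_rcons => /andP[es ez].
by apply: Pe (IH es) ez; apply/connectP; exists s.
Qed.

(** That no triangle carries three different labels reflects that the target is a graph. The
    conclusion allows an edge between [x] and [y] because the labels will be rounded values:
    antipodal points then have nearly equal images. *)
Lemma antipodal_labels_meet (X : finType) (e : rel X) (opp : X -> X)
    (L : eqType) (phi : X -> L) (x0 : X) :
  symmetric e -> reflexive e ->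
  involutive opp -> (forall x y, e (opp x) (opp y) = e x y) ->
  (forall x y, connect e x y) ->
  trivial_H1 e ->
  (forall x y z, e x y -> e y z -> e x z ->
     [|| phi x == phi y, phi y == phi z | phi x == phi z]) ->
  exists x y z, [/\ e x y, phi z = phi x & phi (opp z) = phi y].
Proof.
move=> e_sym e_refl oppK e_opp e_conn H1 lab3.
apply: contrapT => noz.
have sep x y z : e x y -> phi z = phi x -> phi (opp z) = phi y -> False.
  by move=> *; apply: noz; exists x, y, z.
(* [piece x] is the component of [x] in its level set, and [D x] below is the component of [opp x]
   in the complement of that piece. *)
pose r x y := e x y && (phi x == phi y).
have r_sym : symmetric r by move=> x y; rewrite /r e_sym eq_sym.
pose piece x y := connect r x y.
have piece_lab x y : piece x y -> phi y = phi x.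
  by move=> h; apply: (connect_ind (P := fun y => phi y = phi x) h) => // u v _ <- /andP[_ /eqP].
pose a x u v := [&& e u v, ~~ piece x u & ~~ piece x v].
pose D x y := connect (a x) (opp x) y.
have oppNpiece x y : piece x y -> ~~ piece x (opp y).
  move=> xy; apply/negP => /piece_lab; move: (piece_lab _ _ xy) => yx.
  exact: (sep x x y).
have DNpiece x y : D x y -> ~~ piece x y.
  move=> h; apply: (connect_ind (P := fun y => ~~ piece x y) h) => [|u v _ _ /and3P[]//].
  by apply: oppNpiece; exact: connect0.
have oppD x y : piece x y -> D x (opp y).
  move=> h; apply: (connect_ind (P := fun y => D x (opp y)) h) => [|u v xu Du uv].
    exact: connect0.
  apply: connect_trans Du (connect1 _).
  have xv : piece x v by apply: connect_trans xu (connect1 uv).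
  by rewrite /a !oppNpiece// !andbT e_opp; case/andP: uv.
have bdry x u v : D x u -> ~~ D x v -> e u v -> piece x v.
  move=> Du + euv; apply: contraNT => xv.
  apply: (connect_trans Du (connect1 _)). rewrite /a. rewrite euv. rewrite xv. by rewrite DNpiece.
have xND x : ~~ D x x by apply/negP => h; move: (DNpiece _ _ h); rewrite /piece connect0.
pose x := [arg min_(x < x0) #|[pred y | D x y]|].
have xmin y : #|[pred z | D x z]| <= #|[pred z | D y z]|.
  by rewrite /x; case: arg_minnP => // i _; exact.
pose c u v := [&& e u v, ~~ D x u & ~~ D x v].
(* The complement of [D x] is connected: a path coming out of [D x] lands in [piece x], which is
   connected and disjoint from [D x]. *)
have Dc_conn z : ~~ D x z -> connect c x z.
  apply: (connect_ind (P := fun z => ~~ D x z -> connect c x z) (e_conn x z)).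
    by move=> _; exact: connect0.
  move=> u v _ IH euv xv; have [Du|Du] := boolP (D x u).
    have h := bdry _ _ _ Du xv euv.
    apply: (connect_ind (P := connect c x) h) => [|s t xs cs st]; first exact: connect0.
    apply: connect_trans cs (connect1 _); rewrite /c.
    case/andP: (st) => -> _ /=.
    have xt : piece x t by apply: connect_trans xs (connect1 st).
    by rewrite !(contraL (@DNpiece x _)).
  by apply: connect_trans (IH Du) (connect1 _); rewrite /c euv Du.
have [u0 [v0 [Du0 Dv0 e0]]] : exists u v, [/\ D x u, ~~ D x v & e u v].
  apply: contrapT => no.
  have : D x x; last by apply/negP.
  apply: (connect_ind (P := D x) (e_conn (opp x) x)); first exact: connect0.
  by move=> u v _ Du euv; apply: contrapT => /negP Dv; apply: no; exists u, v.
(* The part of the edge boundary of [D x] whose inner endpoint lies in the piece of [u0]. *)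
pose al u v := [|| [&& D x u, ~~ D x v & piece u0 u] | [&& D x v, ~~ D x u & piece u0 v]].
have al_sym u v : al u v = al v u by rewrite /al orbC.
(* The outer vertex lies in [piece x], so both inner labels differ from its label and must agree
   with each other. This makes [al] additive on triangles. *)
have same u v w : D x u -> D x v -> ~~ D x w -> e u v -> e v w -> e u w -> piece u0 u = piece u0 v.
  move=> Du Dv Dw uv vw uw.
  have lw : phi w = phi x by apply: piece_lab; exact: bdry Dv Dw vw.
  have xw := bdry _ _ _ Dv Dw vw.
  have neq t : D x t -> e t w -> phi t != phi w.
    move=> Dt tw; apply/negP => ltw; move/negP: (DNpiece _ _ Dt); apply.
    by apply: connect_trans xw (connect1 _); rewrite /r e_sym tw eq_sym.
  have luv : phi u == phi v.
    by move: (lab3 _ _ _ uv vw uw); rewrite (negbTE (neq _ Dv vw)) (negbTE (neq _ Du uw)) !orbF.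
  have ruv : r u v by rewrite /r uv.
  apply/idP/idP => h; first exact: connect_trans h (connect1 ruv).
  by apply: connect_trans h (connect1 _); rewrite r_sym.
have al_coc : cocycle e al.
  split=> // u v w uv vw uw; rewrite /al.
  have s1 : D x u -> D x v -> ~~ D x w -> piece u0 u = piece u0 v.
    by move=> *; apply: (same _ _ w).
  have s2 : D x u -> D x w -> ~~ D x v -> piece u0 u = piece u0 w.
    by move=> *; apply: (same _ _ v) => //; rewrite e_sym.
  have s3 : D x v -> D x w -> ~~ D x u -> piece u0 v = piece u0 w.
    by move=> *; apply: (same _ _ u) => //; rewrite e_sym.
  move: s1 s2 s3; case: (D x u); case: (D x v); case: (D x w) => //= s1 s2 s3.
  - by rewrite s1.
  - by rewrite s2// orbF addbb.
  - by rewrite addbF.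
  - by rewrite s3// addbF.
  - by rewrite orbF addbb.
have [chi chiE] := H1 _ al_coc.
(* The primitive is constant on [D x] and on its complement, and it changes across the edge from
   [u0] to [v0]; hence [al] holds on every boundary edge. *)
have chiD u : D x u -> chi u = chi (opp x).
  move=> h; apply: (connect_ind (P := fun u => chi u = chi (opp x)) h) => // s t xs ch /and3P[est ps pt].
  have xt : D x t by apply: (connect_trans xs (connect1 _)); rewrite /a est ps pt.
  have := chiE _ _ est; have xs' : D x s := xs; rewrite /al xs' xt /= ch.
  by case: (chi _); case: (chi _).
have chiDc u : ~~ D x u -> chi u = chi x.
  move=> /Dc_conn h; apply: (connect_ind (P := fun u => chi u = chi x) h) => // s t xs ch /and3P[est Ds Dt].
  have := chiE _ _ est; rewrite /al (negbTE Ds) (negbTE Dt) /= ch.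
  by case: (chi _); case: (chi _).
have chi1 : chi (opp x) (+) chi x.
  by rewrite -(chiD _ Du0) -(chiDc _ Dv0) -chiE// /al Du0 Dv0 /piece connect0.
have bdry_piece u v : D x u -> ~~ D x v -> e u v -> piece u0 u.
  move=> Du Dv euv; have := chiE _ _ euv.
  by rewrite (chiD u)// (chiDc v)// chi1 /al Du (negbTE Dv) /= orbF.
(* Otherwise the edge from [opp v0] to [opp u0] would leave [D x], so [opp u0] would lie in
   [piece x] and share the label of [v0], a neighbour of [u0]. *)
have Doppu0 : D x (opp u0).
  apply: contrapT => /negP Dn.
  have xv0 := bdry _ _ _ Du0 Dv0 e0.
  have : piece x (opp u0) by apply: bdry (oppD _ _ xv0) Dn _; rewrite e_opp e_sym.
  move=> /piece_lab h; apply: (sep v0 u0 (opp u0)); rewrite ?oppK ?h 1?e_sym//.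
  by rewrite (piece_lab _ _ xv0).
(* A path that avoids [piece u0] cannot leave [D x], because every exit starts in that piece. *)
have sub y : D u0 y -> D x y.
  move=> h; apply: (connect_ind (P := D x) h) => // s t _ Ds /and3P[est us _].
  apply: contrapT => /negP Dt; move/negP: us; apply.
  exact: bdry_piece Ds Dt est.
have : #|[pred z | D u0 z]| < #|[pred z | D x z]|.
  apply: proper_card; apply/fintype.properP; split; first by apply/fintype.subsetP => y; rewrite !inE; exact: sub.
  by exists u0; rewrite !inE.
by rewrite ltnNge xmin.
Qed.

(** * A combinatorial sphere made of two square grids *)

Section two_squares.
Variable N : nat.

Definition near_nat (i j : nat) := (i <= j.+1) && (j <= i.+1).

Definition on_rim (z : 'I_N.+1 * 'I_N.+1) :=
  [|| z.1 == 0 :> nat, z.1 == N :> nat, z.2 == 0 :> nat | z.2 == N :> nat].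

Definition sphere_point : finType := (bool * ('I_N.+1 * 'I_N.+1))%type.

(** King moves within a sheet. The two rims are not identified; instead, equal or neighbouring rim
    positions of different sheets are adjacent. *)
Definition sphere_adj : rel sphere_point := fun x y =>
  [&& near_nat x.2.1 y.2.1, near_nat x.2.2 y.2.2 &
      (x.1 == y.1) || on_rim x.2 && on_rim y.2].

Definition sphere_opp (x : sphere_point) : sphere_point :=
  (~~ x.1, (rev_ord x.2.1, rev_ord x.2.2)).

Lemma sphere_adj_sym : symmetric sphere_adj.
Proof.
move=> x y; rewrite /sphere_adj /near_nat eq_sym (andbC (on_rim _)).
by rewrite (andbC (x.2.1 <= _)) (andbC (x.2.2 <= _)).
Qed.

Lemma sphere_adj_refl : reflexive sphere_adj.
Proof. by move=> x; rewrite /sphere_adj /near_nat !leqnSn eqxx. Qed.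

Lemma sphere_oppK : involutive sphere_opp.
Proof. by case=> s [i j]; rewrite /sphere_opp /= negbK !rev_ordK. Qed.

Lemma sphere_adj_opp x y : sphere_adj (sphere_opp x) (sphere_opp y) = sphere_adj x y.
Proof.
have nearE (i j : 'I_N.+1) : near_nat (rev_ord i) (rev_ord j) = near_nat i j.
  by rewrite /near_nat /=; have := ltn_ord i; have := ltn_ord j; lia.
have rimE (z : 'I_N.+1 * 'I_N.+1) : on_rim (rev_ord z.1, rev_ord z.2) = on_rim z.
  by rewrite /on_rim /=; have := ltn_ord z.1; have := ltn_ord z.2; lia.
by rewrite /sphere_adj /sphere_opp /= !nearE !rimE (inj_eq negb_inj).
Qed.

Let pt (s : bool) (i j : nat) : sphere_point := (s, (inord i, inord j)).

Let ptE (x : sphere_point) : x = pt x.1 x.2.1 x.2.2.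
Proof. by case: x => s [i j]; rewrite /pt /= !inord_val. Qed.

Let adj_pt s i j i' j' : i <= N -> j <= N -> i' <= N -> j' <= N ->
  near_nat i i' -> near_nat j j' -> sphere_adj (pt s i j) (pt s i' j').
Proof. by move=> *; rewrite /sphere_adj /= !inordK ?ltnS// eqxx !(andbT, andTb); apply/andP. Qed.

Let rim (i j : nat) := [|| i == 0, i == N, j == 0 | j == N].

Let adj_rim s s' i j i' j' : i <= N -> j <= N -> i' <= N -> j' <= N ->
  near_nat i i' -> near_nat j j' -> rim i j -> rim i' j' ->
  sphere_adj (pt s i j) (pt s' i' j').
Proof.
move=> *; rewrite /sphere_adj /on_rim /= !inordK ?ltnS//.
by apply/and3P; split=> //; apply/orP; right; apply/andP.
Qed.

Lemma sphere_connected x y : connect sphere_adj x y.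
Proof.
suff to0 z : connect sphere_adj (pt true 0 0) z.
  by apply: (connect_trans _ (to0 y)); rewrite (sym_connect_sym sphere_adj_sym).
rewrite (ptE z); case: z => s [i j] /=.
have s0 : connect sphere_adj (pt true 0 0) (pt s 0 0) by apply: connect1; apply: adj_rim.
have si : connect sphere_adj (pt true 0 0) (pt s i 0).
  have := ltn_ord i; move: (nat_of_ord i); elim=> [//|k IH] kN.
  apply: (connect_trans (IH (ltnW kN))); apply: connect1.
  by apply: adj_pt => //; rewrite /near_nat; lia.
have := ltn_ord j; move: (nat_of_ord j); elim=> [//|k IH] kN.
apply: (connect_trans (IH (ltnW kN))); apply: connect1.
by apply: adj_pt => //; rewrite /near_nat; have := ltn_ord i; lia.
Qed.

(** Each sheet is a disc, where summing along the bottom row and then up a column gives a primitive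
    [chi]. The mismatch [g] of the two primitives across the rim is constant because the rim is
    connected; adding it on one sheet gives a global primitive. *)
Lemma sphere_trivial_H1 : trivial_H1 sphere_adj.
Proof.
move=> a [a_sym a_coc].
have a_refl x : a x x = false.
  by have := a_coc x x x; rewrite sphere_adj_refl => /(_ isT isT isT) ->; rewrite addbb.
pose bot s i := iteri i (fun k b => b (+) a (pt s k 0) (pt s k.+1 0)) false.
pose chi s i j := iteri j (fun l b => b (+) a (pt s i l) (pt s i l.+1)) (bot s i).
have vert s i j : a (pt s i j) (pt s i j.+1) = chi s i j (+) chi s i j.+1.
  by rewrite /chi /= addbA addbb.
have horiz s i j : i < N -> j <= N -> a (pt s i j) (pt s i.+1 j) = chi s i j (+) chi s i.+1 j.
  move=> iN; elim: j => [_|j IH jN]; first by rewrite /chi /bot /= addbA addbb.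
  (* A diagonal cuts the unit square into two triangles. *)
  rewrite (a_coc _ (pt s i j)); try by [apply: adj_pt; rewrite /near_nat; lia].
  rewrite (a_coc (pt s i j) (pt s i.+1 j)); try by [apply: adj_pt; rewrite /near_nat; lia].
  rewrite a_sym !vert IH ?(ltnW jN)//.
  by case: (chi s i j); case: (chi s i j.+1); case: (chi s i.+1 j); case: (chi s i.+1 j.+1).
have vert' s i j j' : i <= N -> j <= N -> j' <= N -> near_nat j j' ->
    a (pt s i j) (pt s i j') = chi s i j (+) chi s i j'.
  move=> iN jN jN' nj; have : [\/ j = j', j' = j.+1 | j = j'.+1].
    by case: (ltngtP j j') => h; [apply: Or32|apply: Or33|apply: Or31]; move: nj; rewrite /near_nat; lia.
  by case=> ->; rewrite ?a_refl ?addbb ?vert// a_sym vert addbC.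
have horiz' s i j i' : i <= N -> j <= N -> i' <= N -> near_nat i i' ->
    a (pt s i j) (pt s i' j) = chi s i j (+) chi s i' j.
  move=> iN jN iN' nj; have : [\/ i = i', i' = i.+1 | i = i'.+1].
    by case: (ltngtP i i') => h; [apply: Or32|apply: Or33|apply: Or31]; move: nj; rewrite /near_nat; lia.
  case=> E; first by rewrite E a_refl addbb.
    by rewrite E horiz//; lia.
  by rewrite E a_sym horiz 1?addbC//; lia.
have side s i j i' j' : i <= N -> j <= N -> i' <= N -> j' <= N -> near_nat i i' -> near_nat j j' ->
    a (pt s i j) (pt s i' j') = chi s i j (+) chi s i' j'.
  move=> iN jN iN' jN' ni nj.
  rewrite (a_coc _ (pt s i' j)); try by [apply: adj_pt; rewrite /near_nat in ni nj *; lia].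
  by rewrite horiz'// vert'// addbA -(addbA (chi s i j)) addbb addbF.
pose g i j := a (pt true i j) (pt false i j) (+) chi true i j (+) chi false i j.
have aTB i j : a (pt true i j) (pt false i j) = g i j (+) chi true i j (+) chi false i j.
  by rewrite /g; case: (chi true i j); case: (chi false i j); case: (a _ _).
have g_step i j i' j' : i <= N -> j <= N -> i' <= N -> j' <= N -> near_nat i i' -> near_nat j j' ->
    rim i j -> rim i' j' -> g i' j' = g i j.
  move=> iN jN iN' jN' ni nj r r'.
  have := a_coc (pt true i j) (pt true i' j') (pt false i' j').
  rewrite (a_coc (pt true i j) (pt false i j) (pt false i' j')); try by
    [apply: adj_rim => //; rewrite /near_nat; lia].
  rewrite !adj_rim//; try by rewrite /near_nat; lia.
  move=> /(_ isT isT isT); rewrite !side// !aTB.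
  by case: (chi _ _ _); case: (chi _ _ _); case: (chi _ _ _); case: (chi _ _ _); case: (g _ _); case: (g _ _).
have gE i j : i <= N -> j <= N -> rim i j -> g i j = g 0 0.
  have left k : k <= N -> g 0 k = g 0 0.
    by elim: k => [//|k IH kN]; rewrite -(IH (ltnW kN)); apply: g_step; rewrite /near_nat /rim; lia.
  have bottom k : k <= N -> g k 0 = g 0 0.
    by elim: k => [//|k IH kN]; rewrite -(IH (ltnW kN)); apply: g_step; rewrite /near_nat /rim; lia.
  have right k : k <= N -> g N k = g 0 0.
    elim: k => [_|k IH kN]; first exact: bottom.
    by rewrite -(IH (ltnW kN)); apply: g_step; rewrite /near_nat /rim; lia.
  have top k : k <= N -> g k N = g 0 0.
    elim: k => [_|k IH kN]; first exact: left.
    by rewrite -(IH (ltnW kN)); apply: g_step; rewrite /near_nat /rim; lia.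
  by move=> iN jN /or4P[] /eqP->; [apply: left|apply: right|apply: bottom|apply: top].
have cross i j i' j' : i <= N -> j <= N -> i' <= N -> j' <= N -> near_nat i i' -> near_nat j j' ->
    rim i j -> rim i' j' -> a (pt true i j) (pt false i' j') = chi true i j (+) chi false i' j' (+) g 0 0.
  move=> iN jN iN' jN' ni nj r r'.
  rewrite (a_coc _ (pt true i' j')); try by [apply: adj_rim => //; rewrite /near_nat; lia].
  rewrite side// aTB gE//.
  by case: (chi _ _ _); case: (chi _ _ _); case: (chi _ _ _); case: (g _ _).
exists (fun x : sphere_point => chi x.1 x.2.1 x.2.2 (+) (~~ x.1 && g 0 0)) => x y.
rewrite {2}(ptE x) {2}(ptE y); case: x => s [i j]; case: y => s' [i' j'].
have [iN jN iN' jN'] : [/\ i <= N, j <= N, i' <= N & j' <= N] by split; rewrite -ltnS.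
rewrite /sphere_adj /= => /and3P[ni nj].
case: s; case: s' => /=.
- by rewrite side// !addbF.
- by move=> /andP[r r']; rewrite cross// addbF addbA.
- move=> /andP[r r']; rewrite a_sym cross//; try by move: ni nj; rewrite /near_nat; lia.
- by move=> _; rewrite side//; case: (chi _ _ _); case: (chi _ _ _); case: (g _ _).
Qed.
End two_squares.

Local Open Scope ring_scope.

(** * The Poincare-Miranda theorem on a grid *)

(* The cup product of the coboundaries of [s1], [s2], [s3] is a coboundary, so
   its sum over the cube reduces to the faces, where it is [1]. *)
Lemma grid_poincare_miranda (N : nat) (s1 s2 s3 : nat -> nat -> nat -> int) :
  (forall j k, (j <= N)%N -> (k <= N)%N -> s1 0 j k = 0 /\ s1 N j k = 1) ->
  (forall i k, (i <= N)%N -> (k <= N)%N -> s2 i 0 k = 0 /\ s2 i N k = 1) ->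
  (forall i j, (i <= N)%N -> (j <= N)%N -> s3 i j 0 = 0 /\ s3 i j N = 1) ->
  let varies s i j k := exists a b c : nat, [/\ (a <= 1)%N, (b <= 1)%N, (c <= 1)%N &
        s (i + a)%N (j + b)%N (k + c)%N != s i j k :> int] in
  exists i j k, [/\ (i < N)%N, (j < N)%N & (k < N)%N] /\
    [/\ varies s1 i j k, varies s2 i j k & varies s3 i j k].
Proof.
move=> h1 h2 h3 varies.
pose d1 (f : nat -> nat -> nat -> int) i j k := f i.+1 j k - f i j k.
pose d2 (f : nat -> nat -> nat -> int) i j k := f i j.+1 k - f i j k.
pose d3 (f : nat -> nat -> nat -> int) i j k := f i j k.+1 - f i j k.
(* Cubical cup products: [A23], [A13], [A12] are those of the last two coboundaries on squares, [W]
   that of all three on a cell. [W] vanishes on a cell where one of the functions is constant. *)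
pose A23 i j k := d2 s2 i j k * d3 s3 i j.+1 k - d3 s2 i j k * d2 s3 i j k.+1.
pose A13 i j k := d1 s2 i j k * d3 s3 i.+1 j k - d3 s2 i j k * d1 s3 i j k.+1.
pose A12 i j k := d1 s2 i j k * d2 s3 i.+1 j k - d2 s2 i j k * d1 s3 i j.+1 k.
pose W i j k := d1 s1 i j k * A23 i.+1 j k - d2 s1 i j k * A13 i j.+1 k
  + d3 s1 i j k * A12 i j k.+1.
apply: contrapT => none.
have W0 i j k : (i < N)%N -> (j < N)%N -> (k < N)%N -> W i j k = 0.
  move=> iN jN kN; apply: contrapT => Wn0; apply: none; exists i, j, k; split=> //.
  have cst s : ~ varies s i j k -> forall a b c, (a <= 1)%N -> (b <= 1)%N -> (c <= 1)%N ->
      s (i + a)%N (j + b)%N (k + c)%N = s i j k.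
    by move=> nv a b c *; apply: contrapT => /eqP ?; apply: nv; exists a, b, c.
  have all8 s : ~ varies s i j k ->
     [/\ s i.+1 j k = s i j k, s i j.+1 k = s i j k & s i j k.+1 = s i j k] /\
     [/\ s i.+1 j.+1 k = s i j k, s i.+1 j k.+1 = s i j k, s i j.+1 k.+1 = s i j k & s i.+1 j.+1 k.+1 = s i j k].
    move=> /cst h; split; split.
    - by have := h 1%N 0%N 0%N; rewrite addn1 !addn0; apply.
    - by have := h 0%N 1%N 0%N; rewrite addn1 !addn0; apply.
    - by have := h 0%N 0%N 1%N; rewrite addn1 !addn0; apply.
    - by have := h 1%N 1%N 0%N; rewrite !addn1 !addn0; apply.
    - by have := h 1%N 0%N 1%N; rewrite !addn1 !addn0; apply.
    - by have := h 0%N 1%N 1%N; rewrite !addn1 !addn0; apply.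
    - by have := h 1%N 1%N 1%N; rewrite !addn1; apply.
  by split; apply: contrapT => /all8[[e1 e2 e3] [e4 e5 e6 e7]]; apply: Wn0;
    rewrite /W /A23 /A13 /A12 /d1 /d2 /d3 ?e1 ?e2 ?e3 ?e4 ?e5 ?e6 ?e7; ring.
pose S3 F := \sum_(0 <= i < N) \sum_(0 <= j < N) \sum_(0 <= k < N) F i j k : int.
have SW0 : S3 W = 0.
  rewrite /S3 big_nat big1// => i /andP[_ iN]; rewrite big_nat big1// => j /andP[_ jN].
  by rewrite big_nat big1// => k /andP[_ kN]; exact: W0.
pose P23 i j k := s1 i j k * A23 i j k.
pose P13 i j k := s1 i j k * A13 i j k.
pose P12 i j k := s1 i j k * A12 i j k.
have WE i j k : W i j k = d1 P23 i j k - d2 P13 i j k + d3 P12 i j k.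
  by rewrite /W /P23 /P13 /P12 /A23 /A13 /A12 /d1 /d2 /d3; ring.
have : S3 W = S3 (d1 P23) - S3 (d2 P13) + S3 (d3 P12).
  rewrite /S3 -sumrB -big_split; apply: eq_bigr => i _ /=.
  rewrite -sumrB -big_split; apply: eq_bigr => j _ /=.
  by rewrite -sumrB -big_split; apply: eq_bigr => k _ /=.
have tele (f : nat -> int) : \sum_(0 <= i < N) (f i.+1 - f i) = f N - f 0%N.
  by rewrite telescope_sumr.
(* On the faces [k = 0] and [k = N] the function [s3] is constant, so its differences along the face
   vanish; likewise below for [s2] on the faces [j = 0] and [j = N]. *)
have -> : S3 (d3 P12) = 0.
  rewrite /S3 big_nat big1// => i /andP[_ iN]; rewrite big_nat big1// => j /andP[_ jN].
  rewrite tele /P12 /A12 /d1 /d2.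
  have f3 i' j' : (i' <= N)%N -> (j' <= N)%N -> s3 i' j' 0%N = 0 by move=> ? ?; case: (h3 i' j').
  have f3' i' j' : (i' <= N)%N -> (j' <= N)%N -> s3 i' j' N = 1 by move=> ? ?; case: (h3 i' j').
  by rewrite !f3 ?f3' //; try lia; ring.
have -> : S3 (d2 P13) = 0.
  rewrite /S3 big_nat big1// => i /andP[_ iN]; rewrite exchange_big big_nat big1// => k /andP[_ kN].
  rewrite tele /P13 /A13 /d1 /d3.
  have f2 i' j' : (i' <= N)%N -> (j' <= N)%N -> s2 i' 0%N j' = 0 by move=> ? ?; case: (h2 i' j').
  have f2' i' j' : (i' <= N)%N -> (j' <= N)%N -> s2 i' N j' = 1 by move=> ? ?; case: (h2 i' j').
  by rewrite !f2 ?f2' //; try lia; ring.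
pose S2 F := \sum_(0 <= j < N) \sum_(0 <= k < N) F j k : int.
have -> : S3 (d1 P23) = S2 (A23 N).
  rewrite /S3 exchange_big /S2 [LHS]big_nat [RHS]big_nat; apply: eq_bigr => j /andP[_ jN].
  rewrite exchange_big [LHS]big_nat [RHS]big_nat; apply: eq_bigr => k /andP[_ kN] /=.
  rewrite tele /P23; have [-> ->] := h1 j k (ltnW jN) (ltnW kN).
  by rewrite mul1r mul0r subr0.
rewrite SW0 subr0 addr0.
(* On the face [i = N] the same reduction runs one dimension lower and leaves the increment of [s3]
   along the edge [i = j = N], which is 1. *)
pose Q3 j k := s2 N j k * d3 s3 N j k.
pose Q2 j k := s2 N j k * d2 s3 N j k.
have -> : S2 (A23 N) = S2 (fun j k => Q3 j.+1 k - Q3 j k) - S2 (fun j k => Q2 j k.+1 - Q2 j k).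
  rewrite /S2 -sumrB; apply: eq_bigr => j _; rewrite -sumrB; apply: eq_bigr => k _.
  by rewrite /A23 /Q3 /Q2 /d2 /d3; ring.
have -> : S2 (fun j k => Q2 j k.+1 - Q2 j k) = 0.
  rewrite /S2 big_nat big1// => j /andP[_ jN]; rewrite (tele (Q2 j)) /Q2 /d2.
  have f3 i' j' : (i' <= N)%N -> (j' <= N)%N -> s3 i' j' 0%N = 0 by move=> ? ?; case: (h3 i' j').
  have f3' i' j' : (i' <= N)%N -> (j' <= N)%N -> s3 i' j' N = 1 by move=> ? ?; case: (h3 i' j').
  by rewrite !f3 ?f3' //; try lia; ring.
rewrite /S2 exchange_big /= (eq_big_nat _ _ (F2 := fun k => s3 N N k.+1 - s3 N N k)).
  rewrite tele subr0; have [-> ->] := h3 N N (leqnn N) (leqnn N) => /eqP.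
  by rewrite subr0 eq_sym oner_eq0.
move=> k /andP[_ kN]; rewrite (tele (Q3 ^~ k)) /Q3 /d3.
by have [-> ->] := h2 N k (leqnn N) (ltnW kN); rewrite mul1r mul0r subr0.
Qed.

(** * Point configurations on the lp sphere *)

Section signed_power.
Context {R : realType}.
Implicit Types (p r x y : R).

Lemma powR_mean p x y : 1 <= p -> 0 <= x -> 0 <= y ->
  ((x + y) / 2) `^ p <= (x `^ p + y `^ p) / 2.
Proof.
move=> p1 x0 y0.
have h0 : 0 <= (2^-1 : R) by lra.
have h1 : 2^-1 <= (1 : R) by lra.
have : (2^-1 * x + (1 - 2^-1) * y) `^ p <= 2^-1 * x `^ p + (1 - 2^-1) * y `^ p.
  by apply: (convex_powR p1 (Itv01 h0 h1)); rewrite inE/= in_itv/= andbT.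
have -> : 1 - 2^-1 = 2^-1 :> R by lra.
by rewrite -!mulrDr ![2^-1 * _]mulrC.
Qed.

(** Midpoint concavity of the power [r], deduced from the convexity of the inverse power [r^-1]; the
    case [r = 0] is treated apart. *)
Lemma powR_add_le r x y : 0 <= r <= 1 -> 0 <= x -> 0 <= y ->
  x `^ r + y `^ r <= 2 `^ (1 - r) * (x + y) `^ r.
Proof.
move=> /andP[r0 r1] x0 y0; have [->|rn0] := eqVneq r 0.
  by rewrite subr0 !powRr0 powRr1// mulr1; lra.
have rp : 0 < r by rewrite lt_neqAle eq_sym rn0.
have xy0 : 0 <= (x + y) / 2 by lra.
suff h : (x `^ r + y `^ r) / 2 <= ((x + y) / 2) `^ r.
  have half : 2^-1 `^ r = (2 `^ r)^-1 :> R by rewrite -powR_inv1// -powRrM mulN1r powRN.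
  move: h; rewrite powRM ?addr_ge0// half powRB ?pnatr_eq0 ?implybT// powRr1//.
  by rewrite ler_pdivrMr// => /le_trans; apply; rewrite le_eqVlt; apply/orP; left; apply/eqP; ring.
have e z : 0 <= z -> (z `^ r) `^ r^-1 = z by move=> z0; rewrite -powRrM mulfV// powRr1.
have e' z : 0 <= z -> (z `^ r^-1) `^ r = z by move=> z0; rewrite -powRrM mulVf// powRr1.
rewrite -[leLHS]e' ?divr_ge0 ?addr_ge0 ?powR_ge0//.
rewrite ge0_ler_powR ?nnegrE ?powR_ge0//.
apply: le_trans (powR_mean _ _ _) _; rewrite ?powR_ge0 ?invf_ge1//.
by rewrite !e.
Qed.

(** A number in [0, 1] is at most its [r]-th power; this is applied to the shares of [x] and [y] in
    [x + y]. *)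
Lemma powR_subadd r x y : 0 <= r <= 1 -> 0 <= x -> 0 <= y ->
  (x + y) `^ r <= x `^ r + y `^ r.
Proof.
move=> /andP[r0 r1] x0 y0; have [s0|sn0] := eqVneq (x + y) 0.
  have -> : x = 0 by lra.
  by rewrite add0r lerDr powR_ge0.
have sp : 0 < x + y by rewrite lt_neqAle eq_sym sn0 addr_ge0.
have frac z : 0 <= z <= x + y -> z / (x + y) <= (z / (x + y)) `^ r.
  move=> /andP[z0 zs]; have [->|zn0] := eqVneq z 0; first by rewrite mul0r powR_ge0.
  apply: ger1_powR => //; rewrite ler_pdivrMr// mul1r zs andbT.
  by rewrite divr_gt0// lt_neqAle eq_sym zn0.
have fx : 0 <= x <= x + y by lra.
have fy : 0 <= y <= x + y by lra.
have e z : 0 <= z -> z `^ r = (z / (x + y)) `^ r * (x + y) `^ r.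
  by move=> z0; rewrite -powRM ?divfK ?divr_ge0 ?(ltW sp).
rewrite (e x x0) (e y y0) -mulrDl -[leLHS]mul1r ler_wpM2r ?powR_ge0//.
by apply: le_trans (lerD (frac _ fx) (frac _ fy)); rewrite -mulrDl divff.
Qed.

Definition sgpow r x : R := Num.sg x * `|x| `^ r.

Lemma mul_sgpow p x : 1 <= p -> x * sgpow (p - 1) x = `|x| `^ p.
Proof.
move=> p1; rewrite /sgpow mulrA [x * _]mulrC -normrEsg mulr_powRB1//.
exact: lt_le_trans p1.
Qed.

Lemma sgpowN r x : sgpow r (- x) = - sgpow r x.
Proof. by rewrite /sgpow sgrN normrN mulNr. Qed.

(** Equality can fail only at [x = 0], [r = 0], where the sign is 0 but the power is 1. The exponent
    [r = 0] occurs for [p = 1]. *)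
Lemma ger0_sgpow r x : 0 <= x -> sgpow r x <= x `^ r.
Proof.
rewrite le_eqVlt => /predU1P[<-|x0]; first by rewrite /sgpow sgr0 mul0r powR_ge0.
by rewrite /sgpow gtr0_sg// mul1r gtr0_norm.
Qed.

(* The odd extension of the concave power is Hoelder, with the constant coming
   from two points of opposite sign. *)
Lemma sgpow_holder p x y : 1 <= p <= 2 ->
  (x - y) * (sgpow (p - 1) x - sgpow (p - 1) y) <= 2 `^ (2 - p) * `|x - y| `^ p.
Proof.
move=> /andP[p1 p2]; wlog xy : x y / y <= x.
  move=> wl; have [/wl//|/ltW/wl] := leP y x.
  by rewrite distrC -opprB mulNr -mulrN opprB.
have r01 : 0 <= p - 1 <= 1 by lra.
have c1 : 1 <= 2 `^ (2 - p) :> R.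
  by rewrite -[leLHS](powRr0 2) ler_powR//; lra.
have p0 : 0 < p by lra.
rewrite ger0_norm ?subr_ge0// -[in leRHS](@mulr_powRB1 _ (x - y) p) ?subr_ge0// mulrCA.
rewrite ler_wpM2l ?subr_ge0//.
have same a b : 0 <= b <= a -> sgpow (p - 1) a - sgpow (p - 1) b <= 2 `^ (2 - p) * (a - b) `^ (p - 1).
  move=> /andP[b0 ba]; apply: (@le_trans _ _ ((a - b) `^ (p - 1))); last first.
    by rewrite ler_peMl ?powR_ge0.
  have [->|bn0] := eqVneq b 0.
    by rewrite subr0 {2}/sgpow sgr0 mul0r subr0 ger0_sgpow; lra.
  have bp : 0 < b by rewrite lt_neqAle eq_sym bn0.
  rewrite /sgpow !gtr0_sg ?(lt_le_trans bp)// !mul1r !gtr0_norm ?(lt_le_trans bp)//.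
  rewrite lerBlDr; have {1}-> : a = (a - b) + b by lra.
  by rewrite powR_subadd//; lra.
have [y0|y0] := leP 0 y; first by apply: same; lra.
have [x0|x0] := leP x 0.
  have := same (- y) (- x); rewrite !sgpowN !opprK (addrC (- y)) (addrC (- sgpow _ y)); apply; lra.
have := @powR_add_le (p - 1) x (- y) r01; rewrite (_ : 1 - (p - 1) = 2 - p); last by lra.
move=> h; apply: le_trans (h _ _); try lra.
rewrite -sgpowN lerD// ger0_sgpow//; lra.
Qed.

End signed_power.

(** * Caratheodory reduction *)

Lemma linear_dependence (F : fieldType) (I : finType) (k : nat)
    (y : I -> 'rV[F]_k) (S : {set I}) : (k < #|S|)%N ->
  exists mu : I -> F, [/\ forall i, i \notin S -> mu i = 0,
    exists i, mu i != 0 & \sum_i mu i *: y i = 0].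
Proof.
move=> kS; pose M := \matrix_(j < #|S|) y (enum_val j).
have : kermx M != 0.
  rewrite -mxrank_eq0 mxrank_ker -lt0n subn_gt0.
  exact: leq_ltn_trans (rank_leq_col M) kS.
case/rowV0Pn => u /sub_kermxP uM un0.
have [j0 uj0] : exists j, u 0 j != 0.
  apply/existsP; rewrite -[[exists _, _]]negbK negb_exists; apply/negP => /forallP u0.
  by case/eqP: un0; apply/rowP => j; rewrite mxE; apply/eqP; rewrite -[_ == _]negbK.
exists (fun i => \sum_(j < #|S|) u 0 j * (enum_val j == i)%:R); split.
- move=> i iS; rewrite big1// => j _; case: eqP => [ji|]; last by rewrite mulr0.
  by move: (enum_valP j); rewrite ji (negbTE iS).
- exists (enum_val j0); rewrite (bigD1 j0)//= eqxx mulr1 big1 ?addr0// => j jj0.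
  by rewrite (inj_eq enum_val_inj) (negbTE jj0) mulr0.
- under eq_bigr do rewrite scaler_suml.
  rewrite exchange_big/= -[RHS]uM mulmx_sum_row; apply: eq_bigr => j _.
  rewrite (bigD1 (enum_val j))//= eqxx mulr1 rowK big1 ?addr0// => i ij.
  by rewrite eq_sym (negbTE ij) mulr0 scale0r.
Qed.

(** While more than [n + 1] weights are nonzero, an affine dependence of the points can be
    subtracted until a further weight vanishes; the total weight does not change. *)
Lemma conic_caratheodory (R : realFieldType) (I : finType) (n : nat)
    (x : I -> 'rV[R]_n) (l : I -> R) :
  (forall i, 0 <= l i) -> 0 < \sum_i l i -> \sum_i l i *: x i = 0 ->
  exists l' : I -> R, [/\ forall i, 0 <= l' i, forall i, l i = 0 -> l' i = 0,
    0 < \sum_i l' i, \sum_i l' i *: x i = 0 &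
    (#|[set i | l' i != 0%R]| <= n.+1)%N].
Proof.
have [k] := ubnP #|[set i | l i != 0]|.
elim: k l => // k IH l; rewrite ltnS => lk l0 ls lx.
have [?|big] := leqP #|[set i | l i != 0]| n.+1; first by exists l.
rewrite -addn1 in big.
(* The appended coordinate 1 forces the coefficients [mu] to sum to zero. *)
have [mu [muS [i1 mui1]]] := linear_dependence (fun i => row_mx (x i) (1 : 'rV[R]_1)) big.
have -> : \sum_i mu i *: row_mx (x i) (1 : 'rV[R]_1)
    = row_mx (\sum_i mu i *: x i) (\sum_i mu i *: 1).
  elim/big_ind3: _ => [|A B C A' B' C' -> ->|i _]; first by rewrite row_mx0.
    by rewrite add_row_mx.
  by rewrite scale_row_mx.
rewrite -row_mx0 => /eq_row_mx[mux mu1].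
have {}mu1 : \sum_i mu i = 0.
  have := congr1 (fun M : 'rV_1 => M 0 0) mu1; rewrite summxE mxE => h; rewrite -[RHS]h.
  by apply: eq_bigr => i _; rewrite !mxE mulr1.
have [i2 mui2] : exists i, 0 < mu i.
  apply/existsP; rewrite -[[exists _, _]]negbK negb_exists; apply/negP => /forallP npos.
  have {}npos i : 0 <= - mu i by rewrite oppr_ge0 leNgt.
  have := mu1; move/eqP; rewrite -oppr_eq0 -sumrN psumr_eq0// => /allP/(_ i1 (mem_index_enum _)).
  by rewrite oppr_eq0 (negbTE mui1).
(* The least ratio is the largest multiple of [mu] whose removal keeps all weights nonnegative. *)
pose i0 := [arg min_(i < i2 | 0 < mu i) (l i / mu i)]%O.
have [mui0 i0min] : 0 < mu i0 /\ forall i, 0 < mu i -> l i0 / mu i0 <= l i / mu i.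
  by rewrite /i0; case: arg_minP.
pose t := l i0 / mu i0.
pose l' i := l i - t * mu i.
have t0 : 0 <= t by rewrite divr_ge0// ltW.
have l'i0 : l' i0 = 0 by rewrite /l' /t divfK ?subrr// gt_eqF.
have lne i : l i = 0 -> mu i = 0 by move=> li; apply: muS; rewrite inE li eqxx.
have l'0 i : l i = 0 -> l' i = 0 by move=> li; rewrite /l' (lne _ li) li mulr0 subr0.
have := IH l'; case.
- apply: leq_trans _ lk; apply: proper_card; apply/fintype.properP; split.
    by apply/fintype.subsetP => i; rewrite !inE; apply: contra_neq; exact: l'0.
  exists i0; rewrite !inE ?l'i0 ?eqxx//.
  by apply: contraTneq mui0 => /lne ->; rewrite ltxx.
- move=> i; rewrite /l' subr_ge0; have [mi|mi] := leP (mu i) 0.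
    by apply: le_trans (l0 i); rewrite mulr_ge0_le0.
  by rewrite -ler_pdivlMr// i0min.
- by rewrite sumrB -mulr_sumr mu1 mulr0 subr0.
- rewrite (eq_bigr (fun i => l i *: x i - t *: (mu i *: x i))) => [|i _].
    by rewrite sumrB -scaler_sumr mux scaler0 subr0.
  by rewrite scalerBl scalerA.
- move=> l2 [? l2l ? ? ?]; exists l2; split=> // i li.
  exact/l2l/l'0.
Qed.

(** * A Jung-type inequality for the lp sphere *)

Section jung.
Context {R : realType} (p : R).
Hypothesis p12 : 1 <= p <= 2.

Let p1 : 1 <= p. Proof. by case/andP: p12. Qed.
Let p0 : 0 < p. Proof. exact: lt_le_trans p1. Qed.

(** Since the weighted mean of [a] is zero, the cross terms cancel in the weighted double sum of
    [(a i - a j) * (g i - g j)], leaving twice the total weight times the weighted sum of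
    [|a i| ^ p]. Each term is then bounded by [sgpow_holder]. *)
Lemma weighted_spread (I : finType) (a l : I -> R) :
  (forall i, 0 <= l i) -> \sum_i l i * a i = 0 ->
  2 `^ (p - 1) * (\sum_i l i) * (\sum_i l i * `|a i| `^ p) <=
  \sum_i \sum_j l i * l j * `|a i - a j| `^ p.
Proof.
move=> l0 la.
pose g i := sgpow (p - 1) (a i).
have c0 : 0 < 2 `^ (2 - p) :> R by rewrite powR_gt0.
rewrite -(ler_pM2l c0).
have -> : 2 `^ (2 - p) * (2 `^ (p - 1) * (\sum_i l i) * (\sum_i l i * `|a i| `^ p))
   = \sum_i \sum_j l i * l j * ((a i - a j) * (g i - g j)).
  rewrite -mulrA mulrA -powRD ?pnatr_eq0 ?implybT//.
  rewrite (_ : 2 - p + (p - 1) = 1) ?powRr1//; last by ring.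
  transitivity (\sum_i \sum_j (l i * (a i * g i) * l j + l i * (l j * (a j * g j))
      - (l i * a i) * (l j * g j) - (l i * g i) * (l j * a j))); last first.
    by apply: eq_bigr => i _; apply: eq_bigr => j _; ring.
  under [RHS]eq_bigr do rewrite !sumrB big_split/= -!mulr_sumr.
  rewrite !sumrB big_split/= -!mulr_suml la !(mul0r, mulr0) !subr0.
  rewrite [\sum_i l i * `|a i| `^ p](eq_bigr (fun i => l i * (a i * g i))); first by ring.
  by move=> i _; rewrite mul_sgpow.
rewrite mulr_sumr; apply: ler_sum => i _; rewrite mulr_sumr; apply: ler_sum => j _.
rewrite [leRHS]mulrCA ler_wpM2l ?mulr_ge0//; exact: sgpow_holder.
Qed.

(* The bound is attained by the regular tetrahedron inscribed in a cube. *)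
Lemma lp_jung (I : finType) (x : I -> 'rV[R]_3) (l : I -> R) (d : R) :
  (forall i, 0 <= l i) -> 0 < \sum_i l i -> \sum_i l i *: x i = 0 ->
  (forall i, l i != 0 -> lp_norm p (x i) = 1) ->
  (forall i j, l i != 0 -> l j != 0 -> lp_norm p (x i - x j) <= d) ->
  2 * (2 / 3) `^ p^-1 <= d.
Proof.
move=> l0 ls lx nx dx.
have [l' [l'0 l'l l's l'x card4]] := conic_caratheodory l0 ls lx.
have {}l'l i : l' i != 0 -> l i != 0 by apply: contra_neq; exact: l'l.
have {}nx i : l' i != 0 -> lp_norm p (x i) = 1 by move=> /l'l/nx.
have {}dx i j : l' i != 0 -> l' j != 0 -> lp_norm p (x i - x j) <= d.
  by move=> /l'l li /l'l lj; exact: dx.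
move: l' l'0 {l'l} l's l'x card4 nx dx => {l l0 ls lx} l l0 ls lx card4 nx dx.
pose L := \sum_i l i.
have [i0 li0] : exists i, l i != 0.
  apply/existsP; rewrite -[[exists _, _]]negbK negb_exists; apply/negP => /forallP h.
  by move: ls; rewrite big1 ?ltxx// => i _; apply/eqP; rewrite -[_ == _]negbK.
have d0 : 0 <= d by apply: le_trans (dx i0 i0 li0 li0); exact: lp_norm_ge0.
(* Cauchy-Schwarz for at most four nonzero weights; [b] is the indicator of these weights. *)
have sq : L ^+ 2 <= 4 * \sum_i l i ^+ 2.
  pose b i : R := (l i != 0)%:R.
  have bl i : b i * l i = l i.
    by rewrite /b; case: eqVneq => [->|_]; rewrite ?mulr0 ?mul1r.
  have sb : \sum_i b i <= 4.
    have -> : \sum_i b i = #|[set i | l i != 0%R]|%:R.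
      by rewrite -sum1dep_card natr_sum [RHS]big_mkcond; apply: eq_bigr => i _; rewrite /b; case: ifP.
    by rewrite ler_nat.
  have : 0 <= \sum_i \sum_j b i * b j * (l i - l j) ^+ 2.
    by apply: sumr_ge0 => i _; apply: sumr_ge0 => j _; rewrite mulr_ge0 ?sqr_ge0// mulr_ge0.
  have -> : \sum_i \sum_j b i * b j * (l i - l j) ^+ 2
      = 2 * (\sum_i b i) * (\sum_i l i ^+ 2) - 2 * L ^+ 2.
    transitivity (\sum_i \sum_j (l i ^+ 2 * b j + b i * l j ^+ 2 - 2 * l i * l j)).
      apply: eq_bigr => i _; apply: eq_bigr => j _.
      transitivity ((b i * l i) * l i * b j + b i * ((b j * l j) * l j)
        - 2 * (b i * l i) * (b j * l j)); first by ring.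
      by rewrite !bl; ring.
    under eq_bigr do rewrite sumrB big_split/= -!mulr_sumr.
    by rewrite sumrB big_split/= -!mulr_suml -!mulr_sumr /L; ring.
  have s0 : 0 <= \sum_i l i ^+ 2 by apply: sumr_ge0 => i _; exact: sqr_ge0.
  by have := ler_wpM2r s0 sb; lra.
have spread : 2 `^ (p - 1) * L * L <= \sum_i \sum_j l i * l j * lp_norm p (x i - x j) `^ p.
  have coord k : \sum_i l i * x i 0 k = 0.
    have := congr1 (fun M : 'rV_3 => M 0 k) lx; rewrite summxE mxE => h; rewrite -[RHS]h.
    by apply: eq_bigr => i _; rewrite !mxE.
  have LE : L = \sum_(k < 3) \sum_i l i * `|x i 0 k| `^ p.
    rewrite [RHS]exchange_big/=; apply: eq_bigr => i _; rewrite -mulr_sumr -lp_normK//.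
    by have [->|li] := eqVneq (l i) 0; rewrite ?mul0r// nx// powR1 mulr1.
  have -> : \sum_i \sum_j l i * l j * lp_norm p (x i - x j) `^ p
      = \sum_(k < 3) \sum_i \sum_j l i * l j * `|x i 0 k - x j 0 k| `^ p.
    rewrite [RHS]exchange_big/=; apply: eq_bigr => i _.
    rewrite [RHS]exchange_big/=; apply: eq_bigr => j _.
    rewrite lp_normK// mulr_sumr; apply: eq_bigr => k _.
    by rewrite [(x i - x j) 0 k]mxE [(- x j) 0 k]mxE.
  rewrite {2}LE mulr_sumr; apply: ler_sum => k _.
  by apply: weighted_spread.
(* The diagonal terms vanish, and by [sq] the remaining products of weights sum to at most
   [3 / 4 * L ^+ 2]. *)
have upper : \sum_i \sum_j l i * l j * lp_norm p (x i - x j) `^ p <= d `^ p * (3 / 4) * L * L.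
  apply: (@le_trans _ _ (d `^ p * (L ^+ 2 - \sum_i l i ^+ 2))); last first.
    rewrite -!mulrA ler_wpM2l ?powR_ge0//; lra.
  have -> : L ^+ 2 - \sum_i l i ^+ 2 = \sum_i \sum_j (l i * l j - (i == j)%:R * l i ^+ 2).
    rewrite expr2 {1}/L mulr_suml -sumrB; apply: eq_bigr => i _.
    rewrite sumrB -mulr_sumr; congr (_ - _).
    rewrite (bigD1 i)//= eqxx mul1r big1 ?addr0// => j ji.
    by rewrite eq_sym (negbTE ji) mul0r.
  rewrite mulr_sumr; apply: ler_sum => i _; rewrite mulr_sumr; apply: ler_sum => j _.
  have [<-|ij] := eqVneq i j.
    by rewrite subrr lp_norm0// powR0 ?gt_eqF// mulr0 mul1r expr2 subrr mulr0.
  rewrite mul0r subr0 mulrC.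
  have [->|li] := eqVneq (l i) 0; first by rewrite mul0r !mulr0.
  have [->|lj] := eqVneq (l j) 0; first by rewrite !mulr0.
  rewrite ler_wpM2r ?mulr_ge0//.
  by rewrite ge0_ler_powR ?nnegrE ?lp_norm_ge0 ?(ltW p0)// dx.
have h : 2 `^ (p - 1) <= d `^ p * (3 / 4).
  by have := le_trans spread upper; rewrite !ler_pM2r.
rewrite leNgt; apply/negP => dlt.
have := @gt0_ltr_powR _ _ p0 _ _ _ _ dlt.
rewrite !nnegrE => /(_ d0); rewrite mulr_ge0 ?powR_ge0// => /(_ isT).
rewrite powRM ?powR_ge0// -powRrM mulVf ?gt_eqF// powRr1 ?divr_ge0//.
have -> : 2 `^ p = 2 * 2 `^ (p - 1) :> R by rewrite mulr_powRB1.
by move: h; lra.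
Qed.
End jung.

(** * Barycentric coordinates *)

Section counting.
Context {R : realType} (T : finType).

(** The skeleton of dimension [k - 1] of the simplex on [T]: the index counts vertices. *)
Definition bary (k : nat) (y : T -> R) :=
  [/\ forall t, 0 <= y t, \sum_t y t = 1 & (#|[set t | y t != 0%R]%SET| <= k)%N].

Lemma bary_le1 k y t : bary k y -> y t <= 1.
Proof.
by move=> [y0 ys _]; rewrite -ys (bigD1 t)//= lerDl; apply: sumr_ge0.
Qed.

Lemma bary_support k y : bary k y ->
  exists f : nat -> T, forall u, y u != 0 -> exists2 i, (i < k)%N & u = f i.
Proof.
move=> [y0 ys yk]; pose S := [set t | y t != 0%R]%SET.
have [x0 _] : exists t, y t != 0.
  apply: contrapT => no; have : \sum_t y t = 0.
    by apply: big1 => t _; apply: contrapT => /eqP yt; apply: no; exists t.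
  by rewrite ys => /eqP; rewrite oner_eq0.
exists (nth x0 (enum S)) => u yu.
have uS : u \in enum S by rewrite mem_enum inE.
by exists (index u (enum S)); [apply: leq_trans yk; rewrite cardE index_mem|rewrite nth_index].
Qed.

Lemma bary3_support y : bary 3 y ->
  exists t : T * T * T, forall u, y u != 0 -> [|| u == t.1.1, u == t.1.2 | u == t.2].
Proof.
move=> /bary_support[f hf]; exists (f 0%N, f 1%N, f 2%N) => u /hf[i i3 ->] /=.
by case: i i3 => [|[|[|]]]// _; rewrite eqxx ?orbT.
Qed.

(** The coordinates sum to 1, so the third one is determined by the other two and its error is at
    most the sum of theirs, whence the factor 2. *)
Lemma bary_close (y y' : T -> R) (t1 t2 t3 : T) e : 0 <= e ->
  \sum_t y t = 1 -> \sum_t y' t = 1 ->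
  (forall u, y u != 0 -> [|| u == t1, u == t2 | u == t3]) ->
  (forall u, y' u != 0 -> [|| u == t1, u == t2 | u == t3]) ->
  `|y t1 - y' t1| <= e -> `|y t2 - y' t2| <= e ->
  forall t, `|y t - y' t| <= 2 * e.
Proof.
move=> e0 ys ys' S S' c1 c2.
have off t : t != t3 -> `|y t - y' t| <= (t == t1)%:R * e + (t == t2)%:R * e.
  move=> t3t; have [->|n1] := eqVneq t t1.
    by rewrite mul1r (le_trans c1)// lerDl mulr_ge0.
  have [->|n2] := eqVneq t t2; first by rewrite mul0r add0r mul1r.
  have z (w : T -> R) : (forall u, w u != 0 -> [|| u == t1, u == t2 | u == t3]) -> w t = 0.
    move=> h; apply: contrapT => /eqP /h.
    by rewrite (negbTE n1) (negbTE n2) (negbTE t3t).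
  by rewrite !z// subrr normr0 !mul0r addr0.
have one u : \sum_t (t == u)%:R * e = e.
  by rewrite (bigD1 u)//= eqxx mul1r big1 ?addr0// => t /negbTE ->; rewrite mul0r.
move=> t; have [->|/off h] := eqVneq t t3; last first.
  by apply: le_trans h _; case: (t == t1); case: (t == t2); rewrite /= ?mul1r ?mul0r; lra.
have -> : y t3 - y' t3 = - \sum_(t | t != t3) (y t - y' t).
  move: ys ys'; rewrite (bigD1 t3)//= => <-; rewrite (bigD1 t3)//= sumrB => h.
  by lra.
rewrite normrN; apply: le_trans (ler_norm_sum _ _ _) _.
apply: (@le_trans _ _ (\sum_(t | t != t3) ((t == t1)%:R * e + (t == t2)%:R * e))).
  exact: ler_sum.
apply: (@le_trans _ _ (\sum_t ((t == t1)%:R * e + (t == t2)%:R * e))).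
  rewrite [leRHS](bigD1 t3)//= lerDr addr_ge0// mulr_ge0//.
by rewrite big_split/= !one; lra.
Qed.

(* The 2-skeleton needs O(M^2) cells of size 1/M while the target contains
   about M^3 points at mutual distance 1/M. *)
Lemma lipschitz_bary3_misses (g : (T -> R) -> 'I_3 -> R) (c rho : R) : 0 <= c -> 0 < rho ->
  (forall y y' e, bary 3 y -> bary 3 y' -> (forall t, `|y t - y' t| <= e) ->
    forall i, `|g y i - g y' i| <= c * e) ->
  exists q : 'I_3 -> R, (forall i, `|q i| <= rho) /\
    forall y, bary 3 y -> exists i, g y i != q i.
Proof.
move=> c0 rho0 lip; apply: contrapT => hit.
(* With [M = A N], this makes [2 c / M] smaller than the spacing [rho / N] of the target grid. Then
   [N] is chosen so that the [N ^ 3] grid points outnumber the codes, of which there are at most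
   [#|T| ^ 3 * ((A + 1) * N) ^ 2]. *)
pose A := (Num.truncn (2 * c / rho)).+1.
have A_gt : 2 * c / rho < A%:R by exact: truncnS_gt.
pose N := (#|T| ^ 3 * (A + 1) ^ 2).+1.
pose M := (A * N)%N.
have N0 : (0 : R) < N%:R by rewrite ltr0n.
have M0 : (0 : R) < M%:R by rewrite ltr0n.
pose q (z : {ffun 'I_3 -> 'I_N}) i : R := rho * (z i)%:R / N%:R.
have /choice[Y HY] : forall z : {ffun 'I_3 -> 'I_N}, exists y, bary 3 y /\ forall i, g y i = q z i.
  move=> z; apply: contrapT => no; apply: hit; exists (q z); split.
    move=> i; rewrite /q ger0_norm ?divr_ge0 ?mulr_ge0 ?(ltW rho0)//.
    rewrite -mulrA ler_piMr ?(ltW rho0)// ler_pdivrMr// mul1r ler_nat ltnW//.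
  move=> y by3; apply: contrapT => all; apply: no; exists y; split=> // i.
  by apply: contrapT => /eqP ?; apply: all; exists i.
have /choice[t Ht] : forall z, exists t : T * T * T, forall u, Y z u != 0 ->
    [|| u == t.1.1, u == t.1.2 | u == t.2].
  by move=> z; apply: bary3_support; case: (HY z).
pose cell (r : R) : 'I_M.+1 := inord (Num.truncn (M%:R * r)).
have cell_close r r' : 0 <= r <= 1 -> 0 <= r' <= 1 -> cell r = cell r' -> `|r - r'| <= M%:R^-1.
  move=> /andP[r0 r1] /andP[r0' r1'] /(congr1 val); rewrite /=.
  have b (s : R) : 0 <= s -> (Num.truncn (M%:R * s))%:R <= M%:R * s < (Num.truncn (M%:R * s))%:R + 1.
    by move=> s0; have := @truncn_itv R (M%:R * s); rewrite mulr_ge0 ?(ltW M0)// => /(_ isT); rewrite -natr1.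
  have bnd (s : R) : 0 <= s -> s <= 1 -> (Num.truncn (M%:R * s) < M.+1)%N.
    move=> s0 s1; rewrite ltnS -(ler_nat R); have /andP[h _] := b s s0.
    by rewrite (le_trans h)// ler_piMr ?(ltW M0).
  rewrite !inordK ?bnd// => e.
  have := b r r0; have := b r' r0'; rewrite -e => h1 h2.
  rewrite -(ler_pM2l M0) mulfV ?gt_eqF// -{1}(gtr0_norm M0) -normrM ler_norml mulrBr.
  by lra.
(* A triangle together with the rounded values of two coordinates: equal codes put all coordinates
   within [2 / M] of each other. *)
pose code z := (t z, (cell (Y z (t z).1.1), cell (Y z (t z).1.2))).
have code_inj : injective code.
  move=> z z' [] et e1 e2.
  have [[y0 ys _] gq] := HY z; have [[y0' ys' _] gq'] := HY z'.
  have bY z1 u : 0 <= Y z1 u <= 1.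
    by have [b1 _] := HY z1; rewrite (bary_le1 _ b1) andbT; case: b1.
  have close := @bary_close (Y z) (Y z') (t z).1.1 (t z).1.2 (t z).2 M%:R^-1 _ ys ys' (Ht z) _ _ _.
  have {}close u : `|Y z u - Y z' u| <= 2 * M%:R^-1.
    apply: close; first by rewrite invr_ge0 ltW.
    - by rewrite et; exact: Ht.
    - by apply: cell_close; rewrite ?bY// e1 et.
    - by apply: cell_close; rewrite ?bY// e2 et.
  apply/ffunP => i; apply: val_inj.
  have := lip _ _ _ (HY z).1 (HY z').1 close i.
  rewrite gq gq' /q => h.
  have : `|(z i)%:R - (z' i)%:R| < (1 : R).
    rewrite -(ltr_pM2l (divr_gt0 rho0 N0)) -{1}(gtr0_norm (divr_gt0 rho0 N0)) -normrM mulr1.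
    have -> : rho / N%:R * ((z i)%:R - (z' i)%:R) = rho * (z i)%:R / N%:R - rho * (z' i)%:R / N%:R by ring.
    apply: le_lt_trans h _.
    rewrite /M natrM invfM !mulrA ltr_pM2r ?invr_gt0//.
    by move: A_gt; rewrite !ltr_pdivrMr ?ltr0n// mulrC (mulrC c) (mulrC rho).
  rewrite ltr_norml ltrBrDr ltrBlDr => /andP[lo hi].
  have : (z' i < (z i).+1)%N by rewrite -(ltr_nat R) -natr1; move: lo; lra.
  have : (z i < (z' i).+1)%N by rewrite -(ltr_nat R) -natr1; move: hi; lra.
  by move=> /=; lia.
have := leq_card code code_inj.
rewrite card_ffun !card_prod !card_ord.
apply/negP; rewrite -ltnNge.
have h1 : (M.+1 <= (A + 1) * N)%N by rewrite /M; lia.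
apply: (@leq_ltn_trans (#|T| ^ 3 * ((A + 1) * N) ^ 2)).
  have -> : (#|T| * #|T| * #|T| * (M.+1 * M.+1) = #|T| ^ 3 * M.+1 ^ 2)%N.
    by rewrite !expnS !expn0 !muln1 !mulnA.
  by rewrite leq_mul2l leq_exp2r// h1 orbT.
by rewrite expnMn mulnA [(N ^ 3)%N]expnS ltn_pmul2r ?expn_gt0// /N.
Qed.
End counting.

Local Open Scope classical_set_scope.

(** * Compactness *)

Section compactness.
Context {R : realType}.

(** Near each point one index and one threshold suffice, and compactness makes the threshold
    uniform. *)
Lemma compact_bounded_away (T : topologicalType) (I : Type) (f : I -> T -> R) (A : set T) :
  compact A -> (forall i, continuous (f i)) -> (forall x, A x -> exists i, f i x != 0) ->
  exists2 r, 0 < r & forall x, A x -> exists i, r <= `|f i x|.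
Proof.
move=> /compact_near_coveringP cA cf nz.
have : \forall r \near (0 : R)^'+, A `<=` [set x | exists i, r <= `|f i x|].
  apply: cA => x Ax; have [i fi] := nz x Ax.
  have c0 : 0 < `|f i x| / 2 by rewrite divr_gt0// normr_gt0.
  have near_x : \forall x' \near x, `|f i x| / 2 <= `|f i x'|.
    have : (fun y => `|f i y|) @ x --> `|f i x| by apply: cvg_norm; exact: cf.
    move=> /(cvgr_gt `|f i x|)/(_ (`|f i x| / 2)) h.
    have /h : `|f i x| / 2 < `|f i x| by lra.
    by apply: filterS => y; exact: ltW.
  have near_0 : \forall r \near (0 : R)^'+, r <= `|f i x| / 2.
    by near do apply: ltW; exact: nbhs_right_lt.
  exists ([set x' | `|f i x| / 2 <= `|f i x'|], [set r | r <= `|f i x| / 2]) => //.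
  by move=> [x' r] /= [h1 h2]; exists i; exact: le_trans h2 h1.
move=> h; near (0 : R)^'+ => r.
by exists r => //; near: r.
Unshelve. all: end_near. Qed.

(** The second point is free to lie outside [A], since the estimate at each point of [A] holds on a
    full neighbourhood. *)
Lemma compact_unif_continuous n (I : finType) (f : I -> 'rV[R]_n -> R) (A : set 'rV[R]_n) e :
  compact A -> (forall i, continuous (f i)) -> 0 < e ->
  exists2 d, 0 < d & forall x y, A x -> `|x - y| < d -> forall i, `|f i x - f i y| < e.
Proof.
move=> /compact_near_coveringP cA cf e0.
have : \forall d \near (0 : R)^'+, A `<=` [set x | forall y, `|x - y| < d -> forall i, `|f i x - f i y| < e].
  apply: cA => x Ax.
  have : \forall y \near x, forall i, `|f i x - f i y| < e / 2.
    apply: (@filter_forall _ _ (fun i y => `|f i x - f i y| < e / 2) (nbhs x) _) => i; have /cvgrPdist_lt := cf i x; apply.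
    by rewrite divr_gt0.
  move=> /nbhs_ballP[r /= r0 xr].
  exists (ball x (r / 2), [set d | d < r / 2]); first split => /=.
  - by apply: nbhsx_ballx; rewrite divr_gt0.
  - by apply: nbhs_right_lt; rewrite divr_gt0.
  move=> [x' d] /= [xx' dr] y x'y i.
  have bx' : ball x r x' by apply: le_ball xx'; lra.
  have bxy : ball x r y.
    rewrite (splitr r); apply: ball_triangle xx' _.
    by rewrite -ball_normE /ball_/=; exact: lt_trans x'y dr.
  rewrite (splitr e) (le_lt_trans (ler_distD (f i x) _ _))// ltrD//; last exact: xr.
  by rewrite distrC; exact: xr.
move=> h; near (0 : R)^'+ => d.
exists d => // x y Ax; move: x Ax y; near: d; exact: h.
Unshelve. all: end_near. Qed.

Definition cube n (L : R) : set 'rV[R]_n := [set x | forall j, `|x 0 j| <= L].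

Lemma compact_cube n L : compact (@cube n L).
Proof.
have := @rV_compact R n (fun=> `[- L, L]%classic) (fun=> @segment_compact _ _ _).
congr compact; apply/seteqP; split=> x /= h j; have := h j;
  by rewrite in_itv/= ler_norml.
Qed.

Lemma rV_dist_lt n (x : 'rV[R]_n) d : 0 < d -> (forall j, `|x 0 j| < d) -> `|x| < d.
Proof.
move=> d0 xd; rewrite [ltLHS]mx_normrE.
by apply: bigmax_lt => // -[i j] _ /=; rewrite ord1.
Qed.

(** The signs of [h] on a fine grid serve as 0-1 functions for [grid_poincare_miranda]. In the cell
    found, every component changes sign, yet some component has absolute value at least [r] and
    varies by less than [r]. *)
Lemma poincare_miranda3 (L : R) (h : 'I_3 -> 'rV[R]_3 -> R) : 0 < L ->
  (forall i, continuous (h i)) ->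
  (forall i x, cube L x -> x 0 i = L -> 0 < h i x) ->
  (forall i x, cube L x -> x 0 i = - L -> h i x < 0) ->
  exists2 x, cube L x & forall i, h i x = 0.
Proof.
move=> L0 ch hpos hneg; apply: contrapT => nozero.
have nz x : cube L x -> exists i, h i x != 0.
  move=> xL; apply: contrapT => no; apply: nozero; exists x => // i.
  by apply: contrapT => /eqP hi; apply: no; exists i.
have [r r0 hr] := compact_bounded_away (@compact_cube 3 L) ch nz.
have [d d0 hd] := compact_unif_continuous (@compact_cube 3 L) ch r0.
pose N := (Num.truncn (2 * L / d)).+1.
have N0 : 0 < N%:R :> R by rewrite ltr0n.
have NL : 2 * L / N%:R < d.
  by rewrite ltr_pdivrMr// -ltr_pdivrMl// mulrC; exact: truncnS_gt.
pose c (a : nat) : R := L * (2 * a%:R / N%:R - 1).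
have cN : c N = L by rewrite /c -mulrA divff ?gt_eqF//; ring.
have c0 : c 0%N = - L by rewrite /c; ring.
have cL a : (a <= N)%N -> `|c a| <= L.
  move=> aN; rewrite /c normrM (gtr0_norm L0) ler_piMr ?(ltW L0)//.
  have : 0 <= a%:R / N%:R :> R /\ a%:R / N%:R <= 1 :> R.
    by split; [apply: divr_ge0|rewrite ler_pdivrMr// mul1r ler_nat].
  by rewrite ler_norml -mulrA; lra.
have cS a b : (b <= 1)%N -> `|c a - c (a + b)%N| < d.
  move=> b1; apply: le_lt_trans NL; rewrite /c natrD.
  have -> : L * (2 * a%:R / N%:R - 1) - L * (2 * (a%:R + b%:R) / N%:R - 1) = - (2 * L / N%:R * b%:R) by ring.
  rewrite normrN ger0_norm ?ler_piMr ?mulr_ge0 ?invr_ge0 ?ler_wpM2l// ?(ltW L0) ?(ltW N0)//.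
    by rewrite -[leRHS]/(1%:R) ler_nat.
pose pt (i j k : nat) : 'rV[R]_3 := \row_m c (nth 0%N [:: i; j; k] m).
have ptL i j k : (i <= N)%N -> (j <= N)%N -> (k <= N)%N -> cube L (pt i j k).
  by move=> iN jN kN m; rewrite mxE; apply: cL; case: m => [[|[|[|]]]].
pose s m i j k : int := (0 < h m (pt i j k))%R%:R.
have s1 m i j k : cube L (pt i j k) -> pt i j k 0 m = L -> s m i j k = 1.
  by move=> cp pE; rewrite /s hpos.
have s0 m i j k : cube L (pt i j k) -> pt i j k 0 m = - L -> s m i j k = 0.
  by move=> cp pE; rewrite /s ltNge ltW// hneg.
have [||| i [j [k [[iN jN kN] [v0 v1 v2]]]]] := @grid_poincare_miranda N
  (s (inord 0)) (s (inord 1)) (s (inord 2)).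
- by move=> j k jN kN; split; [apply: s0|apply: s1]; rewrite ?mxE ?inordK//; apply: ptL.
- by move=> j k jN kN; split; [apply: s0|apply: s1]; rewrite ?mxE ?inordK//; apply: ptL.
- by move=> j k jN kN; split; [apply: s0|apply: s1]; rewrite ?mxE ?inordK//; apply: ptL.
have [m] := hr (pt i j k) (ptL _ _ _ (ltnW iN) (ltnW jN) (ltnW kN)).
apply/negP; rewrite -ltNge.
have [a [b [e [a1 b1 e1]]]] : exists a b e : nat, [/\ (a <= 1)%N, (b <= 1)%N, (e <= 1)%N &
    s m (i + a)%N (j + b)%N (k + e)%N != s m i j k].
  case: m => [[|[|[|]]]// lm]; [move: v0|move: v1|move: v2];
    by congr (exists a b e, [/\ _, _, _ & s _ _ _ _ != s _ _ _ _]) || idtac;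
    rewrite (_ : inord _ = Ordinal lm)//; apply: val_inj; rewrite /= inordK.
set y := pt (i + a)%N (j + b)%N (k + e)%N; set x := pt i j k => sxy.
have hxy : `|h m x - h m y| < r.
  apply: hd; first by apply: ptL; exact: ltnW.
  apply: rV_dist_lt => // l; rewrite !mxE.
  by case: l => [[|[|[|]]]//= _]; apply: cS.
apply: le_lt_trans hxy; move: sxy; rewrite /s -/x -/y.
case: (ltP 0 (h m x)) => hx; case: (ltP 0 (h m y)) => hy //= _.
  by rewrite !ger0_norm ?subr_ge0; lra.
by rewrite distrC ler0_norm// ger0_norm ?subr_ge0; lra.
Qed.
End compactness.

(** * From an embedding to coordinate functions *)

Section lp_basics.
Context {R : realType} {p : R} (p1 : 1 <= p) (n : nat).
Implicit Types x y : 'rV[R]_n.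

Let p0 : 0 < p. Proof. exact: lt_le_trans p1. Qed.

Lemma lp_normZ a x : lp_norm p (a *: x) = `|a| * lp_norm p x.
Proof.
rewrite /lp_norm (eq_bigr (fun i => `|a| `^ p * `|x 0 i| `^ p)); last first.
  by move=> i _; rewrite mxE normrM powRM.
rewrite -mulr_sumr powRM ?powR_ge0//; last by apply: sumr_ge0 => i _; exact: powR_ge0.
by rewrite -powRrM mulfV ?gt_eqF// powRr1.
Qed.

Lemma coord_le_lp_norm x i : `|x 0 i| <= lp_norm p x.
Proof.
have <- : (`|x 0 i| `^ p) `^ p^-1 = `|x 0 i| by rewrite -powRrM mulfV ?gt_eqF// powRr1.
rewrite ge0_ler_powR ?nnegrE ?powR_ge0 ?invr_ge0 ?(ltW p0)//.
  by apply: sumr_ge0 => j _; exact: powR_ge0.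
by rewrite (bigD1 i)//= lerDl; apply: sumr_ge0 => j _; exact: powR_ge0.
Qed.

Lemma lp_norm_le_sup x M : 0 <= M -> (forall i, `|x 0 i| <= M) -> lp_norm p x <= n%:R * M.
Proof.
move=> M0 xM; have <- : ((n%:R * M) `^ p) `^ p^-1 = n%:R * M.
  by rewrite -powRrM mulfV ?gt_eqF// powRr1// mulr_ge0.
rewrite ge0_ler_powR ?nnegrE ?powR_ge0 ?invr_ge0 ?(ltW p0)//.
  by apply: sumr_ge0 => j _; exact: powR_ge0.
apply: (@le_trans _ _ (\sum_(i < n) M `^ p)).
  by apply: ler_sum => i _; rewrite ge0_ler_powR ?nnegrE ?(ltW p0).
rewrite sumr_const card_ord -[leLHS]mulr_natl powRM// ler_wpM2r ?powR_ge0//.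
have [->|n_gt0] := posnP n; first by rewrite powR_ge0.
by rewrite le1r_powR// ler1n.
Qed.

Lemma lp_norm_le_norm x : lp_norm p x <= n%:R * `|x|.
Proof.
apply: lp_norm_le_sup => // i; rewrite [leRHS]mx_normrE.
by apply: (le_bigmax _ _ (0, i)).
Qed.

Lemma lp_dist_norm x y : `|lp_norm p x - lp_norm p y| <= lp_norm p (x - y).
Proof.
have tri a b : lp_norm p a - lp_norm p b <= lp_norm p (a - b).
  by rewrite lerBlDr -{1}(subrK b a) ler_lp_normD.
by rewrite ler_norml tri lerNl opprB -[in leRHS]lp_normN opprB tri.
Qed.

Lemma continuous_lp_norm : continuous (@lp_norm R p n).
Proof.
move=> x; apply/(@cvgrPdist_lt _ _ _ (nbhs x)) => e e0.
(* The successor keeps the divisor positive when [n = 0]. *)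
have d0 : 0 < e / n.+1%:R by rewrite divr_gt0.
apply: (@filterS _ (nbhs x) _ (ball x (e / n.+1%:R)) _ _ (nbhsx_ballx x _ d0)) => y xy /=.
apply: le_lt_trans (lp_dist_norm _ _) _; apply: le_lt_trans (lp_norm_le_norm _) _.
apply: (@le_lt_trans _ _ (n.+1%:R * `|x - y|)); first by rewrite ler_wpM2r// ler_nat.
by rewrite mulrC -ltr_pdivlMr//; move: xy; rewrite -ball_normE.
Qed.

(** Radial retraction onto the unit ball, by which maps on the ball become maps on the whole
    space. *)
Definition shrink x : 'rV[R]_n := (Num.max 1 (lp_norm p x))^-1 *: x.

Let max_gt0 x : 0 < Num.max 1 (lp_norm p x).
Proof. by rewrite lt_max ltr01. Qed.

Lemma lp_norm_shrink x : lp_norm p (shrink x) = lp_norm p x / Num.max 1 (lp_norm p x).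
Proof. by rewrite lp_normZ gtr0_norm ?invr_gt0// mulrC. Qed.

Lemma lp_norm_shrink_le1 x : lp_norm p (shrink x) <= 1.
Proof. by rewrite lp_norm_shrink ler_pdivrMr// mul1r le_max lexx orbT. Qed.

Lemma lp_norm_shrink_eq1 x : 1 <= lp_norm p x -> lp_norm p (shrink x) = 1.
Proof.
by move=> x1; rewrite lp_norm_shrink max_r// divff// gt_eqF// (lt_le_trans ltr01).
Qed.

Lemma shrink_id x : lp_norm p x <= 1 -> shrink x = x.
Proof. by move=> x1; rewrite /shrink max_l// invr1 scale1r. Qed.

Lemma shrinkN x : shrink (- x) = - shrink x.
Proof. by rewrite /shrink lp_normN scalerN. Qed.

Lemma continuous_shrink : continuous shrink.
Proof.
move=> x; apply: (@continuousZ R _ 'rV[R]_n); last exact: cvg_id.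
apply: (@continuousV R 'rV[R]_n); first by rewrite gt_eqF.
by apply: (@continuous_max R _ (fun=> 1) (@lp_norm R p n)); [exact: cst_continuous|exact: continuous_lp_norm].
Qed.

Definition ball_point x : set_type (lp_unit_ball p1 n) :=
  exist _ (shrink x) (mem_set (lp_norm_shrink_le1 x : lp_unit_ball p1 n (shrink x))).

Lemma mdist_ball (x y : set_type (lp_unit_ball p1 n)) :
  mdist x y = lp_norm p ((set_val x : 'rV[R]_n) - set_val y).
Proof. by []. Qed.

Lemma ball_point_shrink x : ball_point (shrink x) = ball_point x.
Proof. by apply: val_inj; rewrite /= shrink_id// lp_norm_shrink_le1. Qed.

Lemma continuous_ball_point : continuous ball_point.
Proof.
move=> x A /nbhs_ballP[e /= e0 eA].
have d0 : 0 < e / n.+1%:R by rewrite divr_gt0.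
have := @continuous_shrink x; move/(@cvgrPdist_lt _ _ _ (nbhs x))/(_ _ d0).
apply: (@filterS _ (nbhs x)) => y xy; apply: eA; rewrite ballEmdist/= mdist_ball/=.
apply: le_lt_trans (lp_norm_le_norm _) _.
apply: (@le_lt_trans _ _ (n.+1%:R * `|shrink x - shrink y|)).
  by rewrite ler_wpM2r// ler_nat.
by rewrite mulrC -ltr_pdivlMr.
Qed.

End lp_basics.

(** * Coordinates in the weak topology of a polyhedron *)

Section weak_topology.
Context {R : realType} {V : choiceType} (K : simplicial_complex V).
Local Notation P := (polyhedron R K).

Lemma openP (U : set P) : open U <-> polyhedron_open U.
Proof. by []. Qed.

Let open_eval (A : set R) (v : V) : open A ->
  open ((fun w : {ptws V -> R} => w v) @^-1` A).
Proof.
have h : continuous (fun w : {ptws V -> R} => w v : R) := @proj_continuous V (fun=> R) v.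
exact: (iffLR (@continuousP {ptws V -> R} R _) h).
Qed.

Lemma continuous_bary (v : V) : continuous (fun y : P => set_val y v : R).
Proof.
apply/continuousP => A oA; apply/openP => s Ks.
exists ((fun w : {ptws V -> R} => w v) @^-1` A) => //.
exact: open_eval.
Qed.

(** For infinite [W] the weak topology is what helps: on a closed simplex only its finitely many
    vertices impose a condition, the other coordinates being zero. *)
Lemma open_bary_lt (W : set V) (c : V -> R) : (forall v, W v -> 0 < c v) ->
  open [set y : P | forall v, W v -> set_val y v < c v].
Proof.
move=> c0; apply/openP => s Ks.
have open_lt (l : seq V) : open [set w : {ptws V -> R} | forall v, v \in l -> W v -> w v < c v].
  elim: l => [|u l IH].
    by rewrite (_ : [set _ | _] = setT); [exact: openT|apply/seteqP; split].
  have [Wu|Wu] := pselect (W u); last first.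
    rewrite (_ : [set _ | _] = [set w : {ptws V -> R} | forall v, v \in l -> W v -> w v < c v])//.
    apply/seteqP; split=> w /= h v; first by move=> vl; apply: h; rewrite inE vl orbT.
    by rewrite inE => /predU1P[->//|]; exact: h.
  rewrite (_ : [set _ | _] = [set w : {ptws V -> R} | w u < c u] `&`
      [set w : {ptws V -> R} | forall v, v \in l -> W v -> w v < c v]); last first.
    apply/seteqP; split=> w /=.
      by move=> h; split=> [|v vl]; apply: h; rewrite ?mem_head// inE vl orbT.
    by move=> [h1 h2] v; rewrite inE => /predU1P[->//|]; exact: h2.
  apply: openI => //.
  by apply: (open_eval (A := [set r | r < c u])); exact: open_lt.
exists [set w : {ptws V -> R} | forall v, v \in enum_fset s -> W v -> w v < c v] => //.
apply/seteqP; split=> y [fy h]; split=> //; first by move=> v _; exact: h.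
case: (fy) => y0 ys y1 v Wv; have [vs|vs] := boolP (v \in s); first exact: h.
by rewrite ys// c0.
Qed.

End weak_topology.

(** * Reduction to finitely many coordinates *)

Section extraction.
Context {R : realType} {p : R} (p1 : 1 <= p) (n : nat).

(** The complex may be infinite, but a compact image involves only finitely many vertices; their
    barycentric coordinates are the functions [F]. *)
Lemma embedding_coordinates (eps : R) (k : nat) :
  embeds_in_dimension eps (set_type (lp_unit_ball p1 n)) k ->
  exists (T : finType) (F : T -> 'rV[R]_n -> R),
    [/\ forall t, continuous (F t), forall t x, F t (shrink (p := p) x) = F t x,
      forall x, bary k.+1 (F ^~ x) &
      forall x y, (forall t, F t x = F t y) ->
        lp_norm p (shrink (p := p) x - shrink (p := p) y) <= eps].
Proof.
move=> [V [K [[dimK _] [f [cf fib]]]]].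
pose G x := f (ball_point p1 x).
have cG : continuous G.
  by move=> x A /(cf (ball_point p1 x) A) h; exact: (@continuous_ball_point _ _ p1 n x _ h).
pose F v x : R := set_val (G x) v.
have cF v : continuous (F v).
  by move=> x A /(@continuous_bary _ _ K v (G x) A) h; exact: (cG x _ h).
have Gs x : exists2 s, simplices K s & closed_simplex s (F ^~ x).
  by have [s Ks sx] := set_valP (G x); exists s.
have F0 v x : 0 <= F v x by have [s _ []] := Gs x.
pose W v := exists2 x, cube 1 x & 0 < F v x.
have /choice[c Hc] : forall v, exists c, W v -> 0 < c /\ exists2 x, cube 1 x & F v x = c.
  move=> v; have [[x x1 Fx]|nW] := pselect (W v); last by exists 0.
  by exists (F v x) => _; split=> //; exists x.
(* [c v] is a value attained at some point of the cube. A member of a finite subcover that contains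
   this point must have [v] in its set [A], so the union of the finitely many sets [A] contains
   [W]. *)
pose U (A : {fset V}) := G @^-1` [set y | forall v, (W `\` [set` A]) v -> set_val y v < c v].
have oU A : open (U A).
  apply: (iffLR (continuousP _) cG); apply: open_bary_lt => v [Wv _].
  by case: (Hc v Wv).
have := @compact_cube R n 1; rewrite compact_cover => /(_ _ setT U).
case=> [A _|x x1|D _ cov]; first exact: oU.
  have [s Ks [_ xs _]] := Gs x; exists s => // v [Wv /negP vs].
  by rewrite -/(F v x) xs//; case: (Hc v Wv).
pose T0 := (\bigcup_(A <- D) A)%fset.
have WT0 v : W v -> v \in T0.
  move=> Wv; have [cv0 [x x1 Fx]] := Hc v Wv.
  have [A AD Ax] := cov x x1; apply/bigfcupP; exists A; first by rewrite andbT; exact: AD.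
  apply: contrapT => /negP vA; have := Ax v; rewrite -/(F v x) Fx ltxx => h.
  by apply: notF; apply: h; split=> //; apply/negP.
have ball_cube (x : 'rV[R]_n) : lp_norm p x <= 1 -> cube 1 x.
  by move=> x1 i; exact: le_trans (coord_le_lp_norm p1 x i) x1.
have FT0 v x : v \notin T0 -> F v x = 0.
  move=> vT; apply/eqP; rewrite eq_le F0 andbT leNgt; apply/negP => Fx.
  move/negP: vT; apply; apply: WT0; exists (shrink (p := p) x).
    by apply: ball_cube; exact: lp_norm_shrink_le1.
  by rewrite /F /G ball_point_shrink.
exists T0, (fun t => F (val t)); split=> [t|t x|x|x y xy].
- exact: cF.
- by rewrite /F /G ball_point_shrink.
- have [s Ks [_ xs sum1]] := Gs x; split=> [t||]; first exact: F0.
    rewrite -(big_seq_fsetE _ T0 xpredT (F ^~ x)) /= (big_fset_incl _ (fsubsetUl T0 s)).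
      rewrite -(big_fset_incl _ (fsubsetUr T0 s)) ?sum1// => v _ /xs; exact.
    by move=> v _ /FT0.
  apply: leq_trans (dimK _ Ks).
  rewrite cardE -(size_map val); apply: uniq_leq_size.
    by rewrite map_inj_uniq ?enum_uniq//; exact: val_inj.
  move=> v /mapP[t]; rewrite mem_enum inE => Ft ->.
  by apply: contraNT Ft => /xs /eqP.
- have Gxy : G x = G y.
    apply: val_inj; apply/funext => v.
    have [vT|vT] := boolP (v \in T0); first exact: (xy [` vT]%fset).
    by rewrite -[LHS]/(F v x) -[RHS]/(F v y) !FT0.
  have := fib (G y); rewrite -lee_fin => /(le_trans _); apply.
  apply: ereal_sup_ubound; exists (ball_point p1 x), (ball_point p1 y).
  split; [exact: Gxy|reflexivity|].
  by rewrite mdist_ball.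
Qed.
End extraction.

Section separation.
Context {R : realType} {p : R} (p1 : 1 <= p) (n : nat).
Local Notation sh := (@shrink R p n).
Context (T : finType) (F : T -> 'rV[R]_n -> R) (eps : R).
Hypothesis cF : forall t, continuous (F t).
Hypothesis Fsh : forall t x, F t (sh x) = F t x.
Hypothesis fib : forall x y, (forall t, F t x = F t y) -> lp_norm p (sh x - sh y) <= eps.

(** By compactness of the set of pairs, the bound on fibres extends to approximate fibres once [eps]
    is enlarged. *)
Lemma fibre_separation eps' : eps < eps' ->
  exists2 eta, 0 < eta & forall x y, (forall t, `|F t x - F t y| <= eta) -> lp_norm p (sh x - sh y) < eps'.
Proof.
move=> ee'.
pose Z := ('rV[R]_n * 'rV[R]_n)%type.
have cfst (h : 'rV[R]_n -> R) : continuous h -> continuous (fun z : Z => h z.1).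
  by move=> ch z; apply: continuous_comp; [exact: cvg_fst|exact: ch].
have csnd (h : 'rV[R]_n -> R) : continuous h -> continuous (fun z : Z => h z.2).
  by move=> ch z; apply: continuous_comp; [exact: cvg_snd|exact: ch].
have cD : continuous (fun z : Z => lp_norm p (sh z.1 - sh z.2)).
  move=> z; apply: (@continuous_comp Z 'rV[R]_n R (fun z => sh z.1 - sh z.2)); last exact: continuous_lp_norm.
  apply: (@continuousB R 'rV[R]_n Z (fun z => sh z.1) (fun z => sh z.2)).
    by apply: continuous_comp; [exact: cvg_fst|exact: continuous_shrink].
  by apply: continuous_comp; [exact: cvg_snd|exact: continuous_shrink].
(* The extra index measures how far the distance falls below [eps']; it is positive wherever all
   coordinate differences vanish. *)
pose f (o : option T) : Z -> R :=
  if o is Some t then fun z => F t z.1 - F t z.2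
  else fun z => Num.max 0 (eps' - lp_norm p (sh z.1 - sh z.2)).
have cf o : continuous (f o).
  case: o => [t|] z.
    by apply: (@continuousB R R^o); [exact: cfst|exact: csnd].
  apply: (@continuous_max R Z (fun=> 0) (fun z => eps' - lp_norm p (sh z.1 - sh z.2))).
    exact: cst_continuous.
  by apply: (@continuousB R R^o); [exact: cst_continuous|exact: cD].
have nz z : (cube 1 `*` cube 1) z -> exists o, f o z != 0.
  move=> _.
  have [same|diff] := pselect (forall t, F t z.1 = F t z.2).
    by exists None; rewrite /f gt_eqF// lt_max subr_gt0 (le_lt_trans (fib same))// orbT.
  have [t Ft] : exists t, F t z.1 <> F t z.2 by apply/existsNP.
  by exists (Some t); rewrite /f subr_eq0; apply/eqP.
have [r r0 hr] := compact_bounded_away (compact_setX (@compact_cube R n 1) (@compact_cube R n 1)) cf nz.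
exists (r / 2); first by rewrite divr_gt0.
move=> x y xy.
have shc z : cube 1 (sh z).
  by move=> i; apply: le_trans (coord_le_lp_norm p1 _ i) _; exact: lp_norm_shrink_le1.
have [[t|]] := hr (sh x, sh y) (conj (shc x) (shc y)); rewrite /f /=.
  by rewrite !Fsh => h; have := le_trans h (xy t); lra.
have shK z : sh (sh z) = sh z by apply: shrink_id; exact: lp_norm_shrink_le1.
rewrite !shK ger0_norm ?le_max ?lexx// => h.
rewrite -subr_gt0 ltNge; apply/negP => neg.
by case/orP: h; lra.
Qed.
End separation.

(** * Lower bounds *)

Section rounding.
Context {R : realType} (T : finType).
Implicit Types (y : T -> R) (k : {ffun T -> nat}).

Lemma bary2_support y : bary 2 y ->
  exists a b, forall u, y u != 0 -> u = a \/ u = b.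
Proof.
move=> /bary_support[f hf]; exists (f 0%N), (f 1%N) => u /hf[i i2 ->].
by case: i i2 => [|[|]]// _; [left|right].
Qed.

Lemma sum_two (A : nmodType) (a b : T) (f : T -> A) : a != b ->
  (forall u, u != a -> u != b -> f u = 0) -> \sum_u f u = f a + f b.
Proof.
move=> ab f0; rewrite (bigD1 a)//= (bigD1 b)/= ?(eq_sym b)//; congr (_ + _).
by rewrite big1 ?addr0// => u /andP[ua ub]; exact: f0.
Qed.

Lemma sum_one (A : nmodType) (a : T) (f : T -> A) :
  (forall u, u != a -> f u = 0) -> \sum_u f u = f a.
Proof. by move=> f0; rewrite (bigD1 a)//= big1 ?addr0. Qed.

(** On an edge, one coordinate is rounded and the other receives the rest, so both have the same
    error. *)
Lemma bary2_round (m : nat) y : bary 2 y ->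
  exists k, (forall t, `|m%:R * y t - (k t)%:R| <= 2^-1) /\ (\sum_t k t)%N = m.
Proof.
move=> y2; have [a [b ab]] := bary2_support y2; case: (y2) => y0 ys _.
have half0 : `|0 : R| <= 2^-1 by rewrite normr0; lra.
have [eab|nab] := eqVneq a b.
  have z u : u != a -> y u = 0.
    by move=> ua; apply: contrapT => /eqP /ab; rewrite -eab => -[] /eqP; rewrite (negbTE ua).
  exists [ffun t => if t == a then m else 0%N]; split.
    move=> t; rewrite ffunE; case: eqVneq => [->|/z ->]; last by rewrite mulr0 subrr.
    by rewrite -(sum_one z) ys mulr1 subrr.
  apply: (etrans (@sum_one nat a _ _)); last by rewrite ffunE eqxx.
  by move=> u /negbTE ua; rewrite ffunE ua.
have z u : u != a -> u != b -> y u = 0.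
  by move=> ua ub; apply: contrapT => /eqP /ab[] /eqP; apply/negP.
have yab : y a + y b = 1 by rewrite -(sum_two nab z).
pose k := Num.truncn (m%:R * y a + 2^-1).
have /andP[k1 k2] : k%:R <= m%:R * y a + 2^-1 < k%:R + 1.
  have nn : 0 <= m%:R * y a + 2^-1 by rewrite addr_ge0 ?mulr_ge0 ?invr_ge0.
  by have := truncn_itv nn; rewrite -/k -[k.+1%:R]natr1.
have ma : m%:R * y a <= m%:R by rewrite ler_piMr// (bary_le1 _ y2).
have km : (k <= m)%N.
  by rewrite -ltnS -(ltr_nat R) -natr1; lra.
exists [ffun t => if t == a then k else if t == b then (m - k)%N else 0%N]; split.
  move=> t; rewrite ffunE; case: eqVneq => [->|ta].
    by rewrite ler_norml; apply/andP; split; lra.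
  case: eqVneq => [->|tb]; last by rewrite z// mulr0 subrr.
  have -> : y b = 1 - y a by lra.
  by rewrite natrB// mulrBr mulr1 ler_norml; apply/andP; split; lra.
apply: (etrans (@sum_two nat a b _ nab _)).
  by move=> u /negbTE ua /negbTE ub; rewrite ffunE ua ub.
by rewrite !ffunE eqxx eq_sym (negbTE nab) eqxx -[LHS]/(k + (m - k))%N subnKC.
Qed.

(** Such a rounding vanishes off the edge carrying [y], so it is determined by its value at one end.
    That value lies in an open interval of length 2, which contains at most two integers. *)
Lemma bary2_roundings (m : nat) y k1 k2 k3 : bary 2 y ->
  (forall t, (k1 t)%:R < m%:R * y t + 1) -> (forall t, (k2 t)%:R < m%:R * y t + 1) ->
  (forall t, (k3 t)%:R < m%:R * y t + 1) ->
  (\sum_t k1 t)%N = m -> (\sum_t k2 t)%N = m -> (\sum_t k3 t)%N = m ->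
  [|| k1 == k2, k2 == k3 | k1 == k3].
Proof.
move=> y2 h1 h2 h3 s1 s2 s3; have [a [b ab]] := bary2_support y2; case: (y2) => y0 ys _.
have zk k u : (forall t, (k t)%:R < m%:R * y t + 1) -> y u = 0 -> k u = 0%N.
  by move=> h yu; have := h u; rewrite yu mulr0 add0r ltrn1; case: (k u).
have [eab|nab] := eqVneq a b.
  have z u : u != a -> y u = 0.
    by move=> ua; apply: contrapT => /eqP /ab; rewrite -eab => -[] /eqP; rewrite (negbTE ua).
  apply/orP; left; apply/eqP/ffunP => t; have [->|ta] := eqVneq t a.
    have e k : (forall t, (k t)%:R < m%:R * y t + 1) -> (\sum_t k t)%N = m -> k a = m.
      by move=> h <-; apply/esym/(@sum_one nat a) => u /z; exact: zk.
    by rewrite !e.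
  by rewrite !zk// z.
have z u : u != a -> u != b -> y u = 0.
  by move=> ua ub; apply: contrapT => /eqP /ab[] /eqP; apply/negP.
have yab : y a + y b = 1 by rewrite -(sum_two nab z).
have kab k : (forall t, (k t)%:R < m%:R * y t + 1) -> (\sum_t k t)%N = m ->
    (k a + k b)%N = m /\ m%:R * y a - 1 < (k a)%:R < m%:R * y a + 1.
  move=> h s; have e : (k a + k b)%N = m.
    by rewrite -[RHS]s; apply/esym/(@sum_two nat a b _ nab) => u ua ub; apply: zk; rewrite // z.
  split=> //; rewrite h andbT; have := h b; have -> : y b = 1 - y a by lra.
  have : (k a)%:R + (k b)%:R = m%:R :> R by rewrite -natrD e.
  by rewrite mulrBr mulr1; lra.
have keq k k' : (forall t, (k t)%:R < m%:R * y t + 1) -> (forall t, (k' t)%:R < m%:R * y t + 1) ->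
    (k a + k b)%N = m -> (k' a + k' b)%N = m -> k a = k' a -> k == k'.
  move=> h h' e e' ka; apply/eqP/ffunP => t; have [->//|ta] := eqVneq t a.
  have [->|tb] := eqVneq t b.
    by apply/eqP; rewrite -(eqn_add2l (k a)) e ka e'.
  by rewrite !zk// z.
have close (i j : nat) : m%:R * y a - 1 < i%:R -> j%:R < m%:R * y a + 1 -> (j < i.+2)%N.
  by move=> ? ?; rewrite -(ltr_nat R) -!natr1; lra.
have [e1 /andP[l1 r1]] := kab _ h1 s1.
have [e2 /andP[l2 r2]] := kab _ h2 s2.
have [e3 /andP[l3 r3]] := kab _ h3 s3.
have : [\/ k1 a = k2 a, k2 a = k3 a | k1 a = k3 a].
  have := (close _ _ l1 r2, close _ _ l1 r3, close _ _ l2 r1, close _ _ l2 r3, close _ _ l3 r1, close _ _ l3 r2).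
  move=> [[[[[c12 c13] c21] c23] c31] c32].
  have [?|d12] := eqVneq (k1 a) (k2 a); first exact: Or31.
  have [?|d23] := eqVneq (k2 a) (k3 a); first exact: Or32.
  by apply: Or33; lia.
by case=> ?; apply/or3P; [apply: Or31|apply: Or32|apply: Or33]; apply: keq.
Qed.
End rounding.

(** * An odd map from the combinatorial sphere to space *)

Section sphere_map.
Context {R : realType} (M : nat).
Let N := M.+1.

Definition grid_coord (i : nat) : R := 2 * i%:R / N%:R - 1.

Let N0 : 0 < N%:R :> R. Proof. by rewrite ltr0n. Qed.

Lemma grid_coord_le1 i : (i <= N)%N -> `|grid_coord i| <= 1.
Proof.
move=> iN; have h1 : i%:R / N%:R <= 1 :> R by rewrite ler_pdivrMr// mul1r ler_nat.
have h0 : 0 <= i%:R / N%:R :> R by rewrite divr_ge0// ltW.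
by rewrite ler_norml /grid_coord -mulrA; apply/andP; split; lra.
Qed.

Lemma grid_coord_near i j : near_nat i j -> `|grid_coord i - grid_coord j| <= 2 / N%:R.
Proof.
move=> /andP[]; rewrite -!(ler_nat R) -[i.+1%:R]natr1 -[j.+1%:R]natr1 => h1 h2.
have -> : grid_coord i - grid_coord j = (2 / N%:R) * (i%:R - j%:R) by rewrite /grid_coord; ring.
rewrite normrM ger0_norm ?divr_ge0 ?(ltW N0)// ler_piMr ?divr_ge0 ?(ltW N0)//.
by rewrite ler_norml; apply/andP; split; lra.
Qed.

Lemma grid_coord_rev (i : 'I_N.+1) : grid_coord (rev_ord i) = - grid_coord i.
Proof.
rewrite /grid_coord /= subSS natrB; last by rewrite -ltnS.
by field; rewrite pnatr_eq0.
Qed.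

Definition height (z : 'I_N.+1 * 'I_N.+1) : R :=
  1 - Num.max `|grid_coord z.1| `|grid_coord z.2|.

(** The sheets become the two halves of a double pyramid over a square. The factor 2 gives every
    point a coordinate of absolute value at least 1, so that [shrink] sends it to the unit
    sphere. *)
Definition sphere_vec (z : sphere_point N) : 'rV[R]_3 :=
  \row_m (2 * nth 0 [:: grid_coord z.2.1; grid_coord z.2.2; (-1) ^+ z.1 * height z.2] m).

Lemma sphere_vec_opp z : sphere_vec (sphere_opp z) = - sphere_vec z.
Proof.
apply/rowP => -[[|[|[|]]]//= lm]; rewrite !mxE /= ?grid_coord_rev ?mulrN//.
rewrite /height /= !grid_coord_rev !normrN.
by case: (z.1); rewrite /= ?expr0 ?expr1; ring.
Qed.

Lemma height_ge0 z : 0 <= height z.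
Proof. by rewrite subr_ge0 ge_max !grid_coord_le1// -ltnS. Qed.

Lemma height_le1 z : height z <= 1.
Proof. by rewrite lerBlDr lerDl le_max normr_ge0. Qed.

Lemma sphere_vec_cube z : cube 2 (sphere_vec z).
Proof.
move=> -[[|[|[|]]]//= lm]; rewrite !mxE /= normrM ger0_norm// ler_piMr//.
- by rewrite grid_coord_le1// -ltnS.
- by rewrite grid_coord_le1// -ltnS.
- by rewrite normrMsign ger0_norm ?height_ge0 ?height_le1.
Qed.

Lemma sphere_vec_big (z : sphere_point N) : exists m, 1 <= `|sphere_vec z 0 m|.
Proof.
have [h1|h1] := leP 1 (2 * `|grid_coord z.2.1|).
  by exists (inord 0); rewrite !mxE inordK//= normrM ger0_norm.
have [h2|h2] := leP 1 (2 * `|grid_coord z.2.2|).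
  by exists (inord 1); rewrite !mxE inordK//= normrM ger0_norm.
exists (inord 2); rewrite !mxE inordK//= normrM ger0_norm// normrMsign ger0_norm ?height_ge0//.
have : Num.max `|grid_coord z.2.1| `|grid_coord z.2.2| < 2^-1 by rewrite gt_max; apply/andP; split; lra.
by rewrite /height; lra.
Qed.

(** The height varies no faster than the grid coordinates, and it vanishes on the rim, where the
    sheets meet. *)
Lemma sphere_vec_near x y : sphere_adj x y -> forall m, `|(sphere_vec x - sphere_vec y) 0 m| <= 4 / N%:R.
Proof.
move=> /and3P[n1 n2 sxy].
have g1 := grid_coord_near n1; have g2 := grid_coord_near n2.
have two a b : `|a - b| <= 2 / N%:R :> R -> `|2 * a - 2 * b| <= 4 / N%:R.
  by move=> h; rewrite -mulrBr normrM ger0_norm//; lra.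
move=> -[[|[|[|]]]//= lm]; rewrite !mxE /=; apply: two => //.
have hdiff : `|height x.2 - height y.2| <= 2 / N%:R.
  rewrite /height.
  have dist (a b : R) : `| `|a| - `|b| | <= `|a - b| by exact: ler_dist_dist.
  have d1 := le_trans (dist _ _) g1; have d2 := le_trans (dist _ _) g2.
  move: d1 d2; rewrite !ler_norml => /andP[? ?] /andP[? ?].
  by apply/andP; case: (leP `|grid_coord x.2.1| `|grid_coord x.2.2|) => ?;
    case: (leP `|grid_coord y.2.1| `|grid_coord y.2.2|) => ?; split; lra.
have rim0 z : on_rim z -> height z = 0.
  have g0 : `|grid_coord 0| = 1 by rewrite /grid_coord mulr0 mul0r sub0r normrN normr1.
  have gN : `|grid_coord N| = 1.
    by rewrite /grid_coord -mulrA divff ?gt_eqF// (_ : 2 * 1 - 1 = 1 :> R) ?normr1//; ring.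
  have le1 (i : 'I_N.+1) : `|grid_coord i| <= 1 by rewrite grid_coord_le1// -ltnS.
  rewrite /on_rim /height; case/or4P => /eqP e; rewrite e ?g0 ?gN.
  - by rewrite max_l ?subrr.
  - by rewrite max_l ?subrr.
  - by rewrite max_r ?subrr.
  - by rewrite max_r ?subrr.
case/orP: sxy => [/eqP ->|/andP[r1 r2]].
  by rewrite -mulrBr normrMsign.
by rewrite !rim0// !mulr0 subrr normr0 divr_ge0// ltW.
Qed.

End sphere_map.

(** * No embedding into a graph *)

Section lower_bound_2.
Context {R : realType} {p : R} (p1 : 1 <= p).

Lemma no_embedding_dim1 (eps : R) (k : nat) : eps < 2 -> (k <= 1)%N ->
  ~ embeds_in_dimension eps (set_type (lp_unit_ball p1 3)) k.
Proof.
move=> eps2 k1 /embedding_coordinates[T [F [cF Fsh bF fib]]].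
have {}bF x : bary 2 (F ^~ x).
  by have [? ? c] := bF x; split=> //; apply: leq_trans c _; rewrite ltnS.
have [eta eta0 sep] := fibre_separation p1 cF Fsh fib eps2.
(* The final estimate adds [1/m] for each of two pairs with equal labels and [1/(2m)] for an edge,
   less than [3/m]. *)
pose m := (Num.truncn (3 / eta)).+1.
have m0 : 0 < m%:R :> R by rewrite ltr0n.
have m_eta : 3 / m%:R < eta.
  by rewrite ltr_pdivrMr// -ltr_pdivrMl// mulrC; exact: truncnS_gt.
(* After scaling by [m], an edge costs less than 1/2 and rounding at most 1/2, so a label stays
   within 1 of the scaled coordinates at any neighbour. *)
have hm0 : 0 < (2 * m%:R)^-1 :> R by rewrite invr_gt0 mulr_gt0.
have [d d0 ucF] := compact_unif_continuous (@compact_cube R 3 2) cF hm0.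
pose M := Num.truncn (4 / d).
have M_d : 4 / M.+1%:R < d.
  by rewrite ltr_pdivrMr ?ltr0n// -ltr_pdivrMl// mulrC; exact: truncnS_gt.
pose u := @sphere_vec R M.
have /choice[k_ Hk] x := bary2_round m (bF x).
pose phi (z : sphere_point M.+1) := k_ (u z).
have near_lt x y t : sphere_adj x y -> `|F t (u x) - F t (u y)| < (2 * m%:R)^-1.
  move=> xy; apply: ucF; first exact: sphere_vec_cube.
  by apply: rV_dist_lt => // j; apply: le_lt_trans M_d; exact: sphere_vec_near.
have mE : (2 * m%:R)^-1 = m%:R^-1 / 2 :> R by rewrite invfM mulrC.
have near_round x y t : sphere_adj x y -> (phi y t)%:R < m%:R * F t (u x) + 1.
  move=> /(near_lt _ _ t); rewrite -(ltr_pM2l m0) -{1}(gtr0_norm m0) -normrM mE mulrA divff ?gt_eqF//.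
  rewrite mulrBr; have [/(_ t) + _] := Hk (u y).
  by rewrite ler_norml ltr_norml /phi => /andP[? ?] /andP[? ?]; lra.
have [x [y [z [xy zx oy]]]] := antipodal_labels_meet (phi := phi) ((true, (ord0, ord0)) : sphere_point M.+1)
  (@sphere_adj_sym _) (@sphere_adj_refl _) (@sphere_oppK _) (@sphere_adj_opp _)
  (@sphere_connected _) (@sphere_trivial_H1 _)
  (fun x y z xy yz xz => bary2_roundings (bF (u x))
     (fun t => near_round _ _ t (sphere_adj_refl x)) (fun t => near_round _ _ t xy)
     (fun t => near_round _ _ t xz) (Hk (u x)).2 (Hk (u y)).2 (Hk (u z)).2).
have lab_close a b t : phi a = phi b -> `|F t (u a) - F t (u b)| <= m%:R^-1.
  rewrite /phi => ab; have [/(_ t) ha _] := Hk (u a); have [/(_ t) hb _] := Hk (u b).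
  rewrite -(ler_pM2l m0) -{1}(gtr0_norm m0) -normrM divff ?gt_eqF// mulrBr.
  by move: ha hb; rewrite ab !ler_norml => /andP[? ?] /andP[? ?]; apply/andP; split; lra.
have : lp_norm p (shrink (p := p) (u z) - shrink (p := p) (u (sphere_opp z))) < 2.
  apply: sep => t; apply: ltW; apply: le_lt_trans m_eta.
  have c1 := lab_close _ _ t zx; have c2 := near_lt _ _ t xy; have c3 := lab_close _ _ t (esym oy).
  have -> : F t (u z) - F t (u (sphere_opp z)) = (F t (u z) - F t (u x)) + (F t (u x) - F t (u y)) + (F t (u y) - F t (u (sphere_opp z))) by ring.
  apply: le_trans (ler_normD _ _) _; apply: le_trans (lerD (ler_normD _ _) (lexx _)) _.
  by move: c1 c2 c3; rewrite mE; lra.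
rewrite /u sphere_vec_opp shrinkN opprK -mulr2n -scaler_nat lp_normZ//.
rewrite lp_norm_shrink_eq1 ?mulr1 ?ger0_norm ?ltxx//.
have [j hj] := @sphere_vec_big R M z.
exact: le_trans hj (coord_le_lp_norm p1 _ _).
Qed.
End lower_bound_2.

(** * No embedding into a 2-complex *)

Section lower_bound_3.
Context {R : realType} {p : R} (p1 : 1 <= p) (p2 : p <= 2).
Local Notation sh := (@shrink R p 3).

Lemma continuous_lipschitz_comp (T : finType) n (F : T -> 'rV[R]_n -> R) (g : (T -> R) -> R) (c : R) :
  0 <= c -> (forall t, continuous (F t)) ->
  (forall y y' e, (forall t, `|y t - y' t| <= e) -> `|g y - g y'| <= c * e) ->
  continuous (fun x => g (F ^~ x)).
Proof.
move=> c0 cF lip x; apply/(@cvgrPdist_lt _ _ _ (nbhs x)) => e e0.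
have c1 : 0 < c + 1 by lra.
have d0 : 0 < e / (c + 1) by rewrite divr_gt0.
have : \forall y \near x, forall t, `|F t x - F t y| < e / (c + 1).
  apply: (@filter_forall _ _ (fun t y => `|F t x - F t y| < e / (c + 1)) (nbhs x) _) => t.
  by have := cF t x; move/(@cvgrPdist_lt _ _ _ (nbhs x))/(_ _ d0).
apply: (@filterS _ (nbhs x)) => y xy.
apply: (@le_lt_trans _ _ (c * (e / (c + 1)))); first by apply: lip => t; exact: ltW.
rewrite mulrCA -[ltRHS]mulr1 ltr_pM2l// ltr_pdivrMr//; lra.
Qed.

Lemma compact_sphere n : compact [set x : 'rV[R]_n | lp_norm p x = 1].
Proof.
apply: (subclosed_compact _ (@compact_cube R n 1)).
  apply: (@preimage_closed 'rV[R]_n R (@lp_norm R p n) [set y | y = 1]); last exact: closed_eq.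
  by move=> x _; exact: continuous_lp_norm.
by move=> x /= x1 i; rewrite -x1; exact: coord_le_lp_norm.
Qed.

Lemma compact_cube_out n L : compact (cube L `&` [set x : 'rV[R]_n | 1 <= lp_norm p x]).
Proof.
apply: compact_closedI; first exact: compact_cube.
apply: (@preimage_closed 'rV[R]_n R (@lp_norm R p n) [set y | 1 <= y]); last exact: closed_ge.
by move=> x _; exact: continuous_lp_norm.
Qed.

Lemma max0_lip (a b : R) : `|Num.max 0 a - Num.max 0 b| <= `|a - b|.
Proof.
rewrite ler_norml; have := ler_norm (a - b); have := ler_norm (b - a); rewrite (distrC b).
by case: (leP 0 a) => ?; case: (leP 0 b) => ? ? ?; apply/andP; split; lra.
Qed.

Lemma no_embedding_dim2 (eps : R) (k : nat) : eps < 2 * (2 / 3) `^ p^-1 -> (k <= 2)%N ->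
  ~ embeds_in_dimension eps (set_type (lp_unit_ball p1 3)) k.
Proof.
move=> eps0 k2 /embedding_coordinates[T [F [cF Fsh bF fib]]].
have {}bF x : bary 3 (F ^~ x).
  by have [? ? c] := bF x; split=> //; apply: leq_trans c _; rewrite ltnS.
pose eps' := (eps + 2 * (2 / 3) `^ p^-1) / 2.
have ee' : eps < eps' by rewrite /eps'; lra.
have e'0 : eps' < 2 * (2 / 3) `^ p^-1 by rewrite /eps'; lra.
have [eta eta0 sep] := fibre_separation p1 cF Fsh fib ee'.
pose dist (y y' : T -> R) := \sum_t `|y t - y' t|.
have dist_ge0 y y' : 0 <= dist y y' by apply: sumr_ge0.
have coord_dist y y' t : `|y t - y' t| <= dist y y'.
  by rewrite /dist (bigD1 t)//= lerDl; apply: sumr_ge0.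
pose r := eta / 2.
have r0 : 0 < r by rewrite divr_gt0.
(* Coordinatewise errors of this size add up to less than [r] in [dist]. *)
have rT0 : 0 < r / #|T|.+1%:R by rewrite divr_gt0.
have [d d0 ucF] := compact_unif_continuous (@compact_cube R 3 1) cF rT0.
pose S := [set x : 'rV[R]_3 | lp_norm p x = 1].
have S_cube x : S x -> cube 1 x.
  by move=> /= x1 i; rewrite -x1; exact: coord_le_lp_norm.
have : finite_subset_cover S (fun x => ball x d) S.
  have := @compact_sphere 3; rewrite compact_cover; apply.
    by move=> x _; exact: ball_open.
  by move=> x Sx; exists x => //; exact: ballxx.
move=> [D DS cov].
have Dnorm (j : D) : lp_norm p (val j) = 1.
  by have := DS (val j) (valP j); rewrite inE.
(* Positive only for net points whose coordinates are within [r] of [y]; two such points are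
   therefore within [2 r = eta] of each other. *)
pose w (y : T -> R) (j : D) := Num.max 0 (r - dist y (F ^~ (val j))).
have w_ge0 y j : 0 <= w y j by rewrite le_max lexx.
have w_lt y j : w y j != 0 -> dist y (F ^~ (val j)) < r.
  apply: contraNT; rewrite -leNgt => h; apply/eqP/max_idPl; lra.
have net x : S x -> exists j, w (F ^~ x) j != 0.
  move=> Sx; have [z zD zx] := cov x Sx; exists [` (zD : z \in D)]%fset.
  rewrite gt_eqF// lt_max subr_gt0; apply/orP; right => /=.
  have Sz : S z by have := DS z zD; rewrite inE.
  have close t : `|F t x - F t z| <= r / #|T|.+1%:R.
    by rewrite distrC ltW// ucF//; [exact: S_cube|move: zx; rewrite -ball_normE].
  apply: (@le_lt_trans _ _ (\sum_(t : T) r / #|T|.+1%:R)); first by apply: ler_sum => t _; exact: close.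
  rewrite sumr_const -[ltLHS]mulr_natl mulrCA -[ltRHS]mulr1 ltr_pM2l//.
  by rewrite ltr_pdivrMr// mul1r ltr_nat.
pose g (y : T -> R) (i : 'I_3) := \sum_(j : D) w y j * val j 0 i.
pose c : R := #|{: D}|%:R * #|T|%:R.
have coord1 (j : D) i : `|val j 0 i| <= 1 by rewrite -(Dnorm j); exact: coord_le_lp_norm.
have lip i (y y' : T -> R) e : (forall t, `|y t - y' t| <= e) -> `|g y i - g y' i| <= c * e.
  move=> ye; have dyy' : dist y y' <= #|T|%:R * e.
    apply: (@le_trans _ _ (\sum_(t : T) e)); first exact: ler_sum.
    by rewrite sumr_const -[leLHS]mulr_natl.
  rewrite /g -sumrB; apply: le_trans (ler_norm_sum _ _ _) _.
  apply: (@le_trans _ _ (\sum_(j : D) #|T|%:R * e)); last first.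
    by rewrite sumr_const -[leLHS]mulr_natl mulrA.
  apply: ler_sum => j _; rewrite -mulrBl normrM.
  apply: (@le_trans _ _ `|w y j - w y' j|); first by rewrite ler_piMr.
  apply: le_trans (max0_lip _ _) _; apply: le_trans dyy'.
  have -> : r - dist y (F^~ (val j)) - (r - dist y' (F^~ (val j))) = dist y' (F^~ (val j)) - dist y (F^~ (val j)) by ring.
  rewrite /dist -sumrB; apply: le_trans (ler_norm_sum _ _ _) _; apply: ler_sum => t _.
  apply: le_trans (ler_dist_dist _ _) _.
  by rewrite opprB addrA subrK distrC.
have c0 : 0 <= c by rewrite mulr_ge0.
(* The added term vanishes on the ball, is a nonnegative multiple of [sh x] outside it, and
   dominates on the faces of a large cube. *)
pose H i (x : 'rV[R]_3) := g (F ^~ x) i + (x - sh x) 0 i.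
have cH i : continuous (H i).
  move=> x; apply: (@continuousD R R^o).
    exact: (continuous_lipschitz_comp (g := fun y => g y i) c0 cF (lip i)).
  have cX : {for x, continuous (fun x : 'rV[R]_3 => x - sh x)}.
    by apply: (@continuousB R 'rV[R]_3 'rV[R]_3 id sh); [exact: cvg_id|exact: continuous_shrink].
  by move=> A /(@coord_continuous R 1 3 0 i (x - sh x) A) hA; exact: (cX _ hA).
pose Mb : R := #|{: D}|%:R * r.
have g_le y i : `|g y i| <= Mb.
  rewrite /g; apply: le_trans (ler_norm_sum _ _ _) _.
  apply: (@le_trans _ _ (\sum_(j : D) r)); last by rewrite sumr_const -[leLHS]mulr_natl.
  apply: ler_sum => j _; rewrite normrM; apply: (@le_trans _ _ `|w y j|); first by rewrite ler_piMr.
  by rewrite ger0_norm// /w ge_max (ltW r0)/= lerBlDr lerDl.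
(* On a face of the cube, [|g| <= Mb], [|sh x| <= 1] and [|q| <= 1] coordinatewise leave a margin of
   1. *)
pose L := Mb + 3.
have Mb0 : 0 <= Mb by rewrite mulr_ge0// ltW.
have L0 : 0 < L by rewrite /L; lra.
have sh1 x i : `|sh x 0 i| <= 1.
  by apply: le_trans (coord_le_lp_norm p1 _ i) _; exact: lp_norm_shrink_le1.
have H_out x : (cube L `&` [set x | 1 <= lp_norm p x]) x -> exists i, H i x != 0.
  move=> [_ /= x1]; apply: contrapT => no.
  have H0 i : H i x = 0 by apply: contrapT => /eqP ?; apply: no; exists i.
  (* A zero of [H] at [x] is a nonnegative dependence between [sh x], with weight [lp_norm p x - 1],
     and the active net points, to which [lp_jung] applies. *)
  pose l (o : unit + D) := if o is inr j then w (F ^~ x) j else lp_norm p x - 1.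
  pose v (o : unit + D) := if o is inr j then val j else sh x.
  have Ssh : S (sh x) by exact: lp_norm_shrink_eq1.
  have sumE (A : nmodType) (h : unit + D -> A) : \sum_o h o = h (inl tt) + \sum_j h (inr j).
    by rewrite big_sumType /= (bigD1 tt)//= [in X in _ + X + _]big1 ?addr0// => -[].
  have : 2 * (2 / 3) `^ p^-1 <= eps'.
    apply: (@lp_jung R p _ _ v l eps'); first by rewrite p1.
    - by case=> [[]|j] //=; rewrite subr_ge0.
    - rewrite sumE /=; have [j wj] := net _ Ssh.
      rewrite ltr_wpDl ?subr_ge0// (bigD1 j)//= ltr_pwDl//.
        by rewrite lt_neqAle eq_sym w_ge0 andbT; move: wj; congr (_ != _); apply: (congr1 (w ^~ j)); apply/funext => t; rewrite Fsh.
      by apply: sumr_ge0.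
    - apply/rowP => i; rewrite sumE /= [RHS]mxE -[RHS](H0 i) /H.
      have -> : x - sh x = (lp_norm p x - 1) *: sh x.
        rewrite scalerBl scale1r /shrink max_r// scalerA divff ?scale1r//.
        by rewrite gt_eqF// (lt_le_trans ltr01).
      rewrite mxE summxE addrC; congr (_ + _); apply: eq_bigr => j _.
      by rewrite mxE.
    - by case=> [[]|j] _ /=; [|exact: Dnorm].
    - have dFw j : w (F ^~ x) j != 0 -> forall t, `|F t x - F t (val j)| < r.
        by move=> /w_lt h t; exact: le_lt_trans (coord_dist (F ^~ x) (F ^~ (val j)) t) h.
      have shj (j : D) : sh (val j) = val j by apply: shrink_id; rewrite Dnorm.
      have eta2 : eta = r + r by rewrite /r; lra.
      case=> [[]|j] [[]|j'] /= lj lj'.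
      + by apply/ltW/sep => t; rewrite subrr normr0 ltW.
      + rewrite -(shj j'); apply/ltW/sep => t.
        by apply: ltW; apply: lt_trans (dFw _ lj' t) _; rewrite eta2; lra.
      + rewrite -{1}(shj j); apply/ltW/sep => t; rewrite distrC.
        by apply: ltW; apply: lt_trans (dFw _ lj t) _; rewrite eta2; lra.
      + rewrite -{1}(shj j) -(shj j'); apply/ltW/sep => t; rewrite eta2.
        apply: le_trans (ler_distD (F t x) _ _) _.
        by apply: lerD; apply: ltW; rewrite 1?distrC; [exact: dFw|rewrite distrC; exact: dFw].
  by rewrite leNgt e'0.
have [rho rho0 Hrho] := compact_bounded_away (@compact_cube_out 3 L) cH H_out.
(* Below [rho], so that a solution of [H = q] has norm less than 1, where [H] reduces to [g]; at
   most 1 for the signs on the faces. *)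
pose rho' := Num.min 1 (rho / 2).
have rho'0 : 0 < rho' by rewrite lt_min ltr01 divr_gt0.
have rho'1 : rho' <= 1 by rewrite ge_min lexx.
have rho'r : rho' < rho by rewrite gt_min; apply/orP; right; lra.
have [q [q_le q_miss]] := lipschitz_bary3_misses c0 rho'0 (fun y y' e _ _ ye i => lip i y y' e ye).
have subE x i : (x - sh x) 0 i = x 0 i - sh x 0 i by rewrite mxE; congr (_ + _); rewrite mxE.
have cHq i : continuous (fun x => H i x - q i).
  by move=> x; apply: (@continuousB R R^o); [exact: cH|exact: cst_continuous].
have Hpos i x : cube L x -> x 0 i = L -> 0 < H i x - q i.
  move=> _ xi; have := g_le (F ^~ x) i; have := sh1 x i; have := q_le i.
  rewrite /H subE xi /L !ler_norml => /andP[? ?] /andP[? ?] /andP[? ?]; lra.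
have Hneg i x : cube L x -> x 0 i = - L -> H i x - q i < 0.
  move=> _ xi; have := g_le (F ^~ x) i; have := sh1 x i; have := q_le i.
  rewrite /H subE xi /L !ler_norml => /andP[? ?] /andP[? ?] /andP[? ?]; lra.
have [x xL Hx] := poincare_miranda3 L0 cHq Hpos Hneg.
have {}Hx i : H i x = q i by apply/eqP; rewrite -subr_eq0 Hx.
have [x1|x1] := leP 1 (lp_norm p x).
  have [i] := Hrho x (conj xL x1); rewrite Hx => h.
  by have := le_trans h (q_le i); lra.
have [i] := q_miss _ (bF x); apply/negP; rewrite negbK -(Hx i) /H shrink_id ?ltW//.
by rewrite subrr mxE addr0.
Qed.
End lower_bound_3.

(** * Upper bounds *)

Section skeleton.
Variables (n k : nat).

Definition skeleton_simplices : set {fset 'I_n} :=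
  [set s | s != fset0 /\ (#|` s| <= k.+1)%N].

Lemma skeleton_neq0 s : skeleton_simplices s -> s != fset0.
Proof. by case. Qed.

Lemma skeleton_down s t : skeleton_simplices s -> t != fset0 -> (t `<=` s)%fset ->
  skeleton_simplices t.
Proof. by move=> [_ sk] t0 ts; split=> //; apply: leq_trans sk; exact: fsubset_leq_card. Qed.

Definition skeleton := SimplicialComplex skeleton_neq0 skeleton_down.

Lemma skeleton_dimension : (k < n)%N -> has_dimension skeleton k.
Proof.
move=> kn; split=> [s []//|].
pose s := [fset widen_ord kn i | i in 'I_k.+1]%fset.
have cs : #|` s| = k.+1.
  by rewrite card_imfset /= -?cardE ?card_ord// => i j /(congr1 val) /= ?; exact: val_inj.
by exists s => //; split; rewrite ?cs// -cardfs_gt0 cs.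
Qed.

Context {R : realType} {X : metricType R} (g : X -> 'I_n -> R).
Hypothesis cg : forall v, continuous (g ^~ v).
Hypothesis bg : forall x, bary k.+1 (g x).

Let supp x : {fset 'I_n} := [fset v in 'I_n | g x v != 0]%fset.

Let in_face x (s : {fset 'I_n}) : (forall v, v \notin s -> g x v = 0) ->
  closed_simplex s (g x : {ptws 'I_n -> R}).
Proof.
move=> xs; have [g0 g1 _] := bg x; split=> //.
rewrite -[RHS]g1 (big_uniq _ (fset_uniq s)) [RHS](bigID (mem s))/=.
by rewrite [X in _ = _ + X]big1 ?addr0// => v /xs.
Qed.

Let supp_simplex x : skeleton_simplices (supp x).
Proof.
have [g0 g1 gk] := bg x.
have sE v : (v \in supp x) = (g x v != 0) by rewrite in_fset.
split.
  apply/eqP => s0; have : \sum_v g x v = 0.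
    apply: big1 => v _; apply/eqP; rewrite -[_ == _]negbK -sE s0 in_fset0//.
  by rewrite g1 => /eqP; rewrite oner_eq0.
apply: leq_trans gk; rewrite cardE.
apply: uniq_leq_size; first exact: fset_uniq.
by move=> v; rewrite sE mem_enum inE.
Qed.

Let in_polyhedron x :
  (\bigcup_(s in simplices skeleton) closed_simplex s) (g x : {ptws 'I_n -> R}).
Proof.
exists (supp x); first exact: supp_simplex.
apply: in_face => v vs; apply/eqP; rewrite -[_ == _]negbK.
by move: vs; rewrite in_fset.
Qed.

Definition skeleton_map x : polyhedron R skeleton :=
  exist _ (g x : {ptws 'I_n -> R}) (mem_set (in_polyhedron x)).

(** There are finitely many faces. One that contains the image of [x] supplies a neighbourhood by
    openness of [U]; any other is avoided near [x], where some coordinate off it stays nonzero. *)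
Lemma continuous_skeleton_map : continuous skeleton_map.
Proof.
apply/continuousP => U oU; rewrite openE => x Ux.
have cgx : continuous (fun x => g x : {ptws 'I_n -> R}).
  move=> y; apply/cvg_sup => v A [_ [[W oW <-] Wy WA]].
  have h : nbhs y (g ^~ v @^-1` W) by apply: (@cg v y W); exact: open_nbhs_nbhs.
  by apply: (@filterS _ (nbhs y) _ _ _ _ h) => z; exact: WA.
pose Q (s : {fset 'I_n}) y := (skeleton_simplices s /\ forall v, v \notin s -> g y v = 0) -> U (skeleton_map y).
have nQ s : \forall y \near x, Q s y.
  have [sK|sK] := pselect (skeleton_simplices s); last by near=> y => -[].
  have [W oW UW] := oU s sK.
  have [xs|xs] := pselect (forall v, v \notin s -> g x v = 0).
    have Wx : W (g x).
      have : ([set y : polyhedron R skeleton | closed_simplex s (set_val y)] `&` U) (skeleton_map x).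
        by split=> //; exact: in_face.
      by rewrite UW => -[].
    have : nbhs x ((fun x => g x : {ptws 'I_n -> R}) @^-1` W).
      by apply: cgx; exact: open_nbhs_nbhs.
    apply: (@filterS _ (nbhs x)) => y Wy [_ ys].
    have : ([set y : polyhedron R skeleton | closed_simplex s (set_val y)] `&` set_val @^-1` W) (skeleton_map y).
      by split=> //; exact: in_face.
    by rewrite -UW => -[].
  have [v /not_implyP[vs gv]] : exists v, ~ (v \notin s -> g x v = 0) by exact/existsNP.
  have : nbhs x (g ^~ v @^-1` [set r | r != 0]).
    by apply: (@cg v x [set r | r != 0]); apply: open_nbhs_nbhs; split; [exact: open_neq|apply/eqP].
  by apply: (@filterS _ (nbhs x)) => y /= gy [_ /(_ v vs)] /eqP; rewrite (negbTE gy).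
have : \forall y \near x, forall s, Q s y by apply: (@filter_forall _ _ Q (nbhs x) _).
apply: (@filterS _ (nbhs x)) => y /(_ (supp y)); apply; split; first exact: supp_simplex.
move=> v vs; apply/eqP; rewrite -[_ == _]negbK.
by move: vs; rewrite in_fset.
Unshelve. all: end_near. Qed.

Lemma skeleton_embedding eps : (k < n)%N ->
  (forall x y, (forall v, g x v = g y v) -> mdist x y <= eps) ->
  embeds_in_dimension eps X k.
Proof.
move=> kn fib; exists 'I_n, skeleton; split; first exact: skeleton_dimension.
exists skeleton_map; split; first exact: continuous_skeleton_map.
move=> z; apply: ge_ereal_sup => _ [x [y [fx fy ->]]]; rewrite lee_fin.
apply: fib => v; have : skeleton_map x = skeleton_map y by rewrite fx fy.
by move/(congr1 (fun w => set_val w v)).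
Qed.
End skeleton.

(** * Power inequalities for the legs of the tripods *)

Section power_estimates.
Context {R : realType} (p : R).
Hypothesis p1 : 1 <= p.

Let p0 : 0 < p. Proof. exact: lt_le_trans p1. Qed.

(** Subadditivity of the power [p^-1], applied to the [p]-th powers. *)
Lemma powR_superadd (a b : R) : 0 <= a -> 0 <= b -> a `^ p + b `^ p <= (a + b) `^ p.
Proof.
move=> a0 b0.
have r01 : 0 <= p^-1 <= 1 by rewrite invr_ge0 ltW//= invf_le1.
have K (c : R) : 0 <= c -> (c `^ p) `^ p^-1 = c by move=> c0; rewrite -powRrM mulfV ?gt_eqF// powRr1.
have := powR_subadd r01 (powR_ge0 a p) (powR_ge0 b p); rewrite !K// => h.
have s0 : 0 <= a `^ p + b `^ p by rewrite addr_ge0 ?powR_ge0.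
have <- : ((a `^ p + b `^ p) `^ p^-1) `^ p = a `^ p + b `^ p.
  by rewrite -powRrM mulVf ?gt_eqF// powRr1.
by rewrite ge0_ler_powR ?nnegrE ?powR_ge0 ?addr_ge0 ?(ltW p0).
Qed.

Lemma powR_pair_ge (u w s : R) : u + w = s -> 2 * `|s / 2| `^ p <= `|u| `^ p + `|w| `^ p.
Proof.
move=> <-; have := powR_mean p1 (normr_ge0 u) (normr_ge0 w).
have : `|(u + w) / 2| `^ p <= ((`|u| + `|w|) / 2) `^ p.
  rewrite ge0_ler_powR ?nnegrE ?divr_ge0 ?addr_ge0 ?(ltW p0)//.
  by rewrite normrM (ger0_norm (_ : 0 <= 2^-1)) ?invr_ge0// ler_pM2r ?invr_gt0// ler_normD.
by lra.
Qed.

(** The arguments on the right will be the coordinates of a point up to sign, and [(cl - ck) / 4]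
    the length of its slide. The first term alone dominates one power, and convexity bounds the
    other two, whose arguments sum to [- (cl - ck) / 2]. *)
Lemma least_gap_bound (ck cl ci cj : R) : ck + cl + ci + cj = 0 ->
  ck <= cl -> cl <= ci -> cl <= cj ->
  3 * ((cl - ck) / 4) `^ p <=
  `|(ck + cl) / 2| `^ p + `|(ck + ci) / 2| `^ p + `|(ck + cj) / 2| `^ p.
Proof.
move=> s0 kl li lj.
have h1 : ((cl - ck) / 4) `^ p <= `|(ck + cl) / 2| `^ p.
  rewrite ge0_ler_powR ?nnegrE ?(ltW p0) ?divr_ge0 ?subr_ge0//.
  by rewrite ler_normr; apply/orP; right; lra.
have e : (ck + ci) / 2 + (ck + cj) / 2 = - (cl - ck) / 2 by lra.
have := powR_pair_ge e; rewrite (_ : - (cl - ck) / 2 / 2 = - ((cl - ck) / 4)); last by field.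
rewrite normrN ger0_norm ?divr_ge0 ?subr_ge0//; lra.
Qed.

(** Two vertices of the tetrahedron differ in two signs, so the left side is the [p]-th power of the
    norm of the difference of their multiples by [a] and [b]. If [b <= a], superadditivity bounds it
    by [2 * (2 * a) ^ p]. *)
Lemma two_gap_bound (a b : R) : 0 <= a -> 0 <= b -> 3 * a `^ p <= 1 -> 3 * b `^ p <= 1 ->
  `|a - b| `^ p + 2 * (a + b) `^ p <= 2 `^ p * (2 / 3).
Proof.
move=> a0 b0; wlog ba : a b a0 b0 / b <= a.
  move=> wl; have [/wl|/ltW/wl] := leP b a; first exact.
  by rewrite distrC (addrC a b) => h ? ?; exact: h.
move=> a1 _; rewrite ger0_norm ?subr_ge0//.
have ab0 : 0 <= a - b by rewrite subr_ge0.
have s0 : 0 <= a + b by exact: addr_ge0.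
have h1 := powR_superadd ab0 s0.
have e : a - b + (a + b) = 2 * a by ring.
have h2 : (a + b) `^ p <= (2 * a) `^ p.
  by rewrite ge0_ler_powR ?nnegrE ?(ltW p0) ?mulr_ge0//; lra.
rewrite e in h1; have eM : (2 * a) `^ p = 2 `^ p * a `^ p by rewrite powRM.
have := powR_gt0 p (ltr0n R 2); rewrite eM in h1 h2 => c0.
have : 2 `^ p * (3 * a `^ p) <= 2 `^ p * 1 by rewrite ler_wpM2l// ltW.
by lra.
Qed.
End power_estimates.

(** * Coordinates adapted to the tetrahedron *)

Section tetrahedral_coordinates.
Context {R : realType}.
Implicit Types x y : 'rV[R]_3.

(* Inner products with the vertices (1,1,1), (1,-1,-1), (-1,1,-1), (-1,-1,1). *)
Definition tetra x (v : 'I_4) : R :=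
  let x0 := x 0 (inord 0) in let x1 := x 0 (inord 1) in let x2 := x 0 (inord 2) in
  nth 0 [:: x0 + x1 + x2; x0 - x1 - x2; - x0 + x1 - x2; - x0 - x1 + x2] v.

Lemma sum4 (A : nmodType) (h : 'I_4 -> A) :
  \sum_v h v = h (inord 0) + h (inord 1) + h (inord 2) + h (inord 3).
Proof.
rewrite !big_ord_recl big_ord0 addr0 !addrA.
by congr (_ + _ + _ + _); congr h; apply: val_inj; rewrite /= ?inordK.
Qed.

Lemma sum3 (A : nmodType) (h : 'I_3 -> A) :
  \sum_v h v = h (inord 0) + h (inord 1) + h (inord 2).
Proof.
rewrite !big_ord_recl big_ord0 addr0 !addrA.
by congr (_ + _ + _); congr h; apply: val_inj; rewrite /= ?inordK.
Qed.

Lemma tetra_sum x : \sum_v tetra x v = 0.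
Proof. by rewrite sum4 /tetra !inordK//=; ring. Qed.

Lemma tetraB x y v : tetra (x - y) v = tetra x v - tetra y v.
Proof.
rewrite /tetra; have e i : (x - y) 0 i = x 0 i - y 0 i by rewrite mxE; congr (_ + _); rewrite mxE.
by rewrite !e; case: v => [[|[|[|[|]]]]//= _]; ring.
Qed.

Lemma tetra_inj x : (forall v, tetra x v = 0) -> x = 0.
Proof.
move=> h; have := h (inord 0); have := h (inord 1); have := h (inord 2); have := h (inord 3).
rewrite /tetra !inordK//= => h3 h2 h1 h0.
apply/rowP => -[[|[|[|]]]// li]; rewrite mxE.
- by rewrite (_ : Ordinal li = inord 0); [lra|apply: val_inj; rewrite /= inordK].
- by rewrite (_ : Ordinal li = inord 1); [lra|apply: val_inj; rewrite /= inordK].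
- by rewrite (_ : Ordinal li = inord 2); [lra|apply: val_inj; rewrite /= inordK].
Qed.

(** Two distinct vertices sum to plus or minus twice a basis vector, so the half sums over [v != k]
    run through the coordinates of [x] up to sign. *)
Lemma tetra_even_sum (f : R -> R) x (k : 'I_4) : (forall t, f (- t) = f t) ->
  \sum_v f ((tetra x k + tetra x v) / 2) = f (tetra x k) + \sum_(j < 3) f (x 0 j).
Proof.
move=> fN; rewrite sum4 sum3.
set x0 := x 0 (inord 0); set x1 := x 0 (inord 1); set x2 := x 0 (inord 2).
have e (a b : R) : a = b \/ a = - b -> f a = f b by case=> ->.
rewrite /tetra !inordK//= -/x0 -/x1 -/x2.
case: k => [[|[|[|[|]]]]//= _].
- transitivity (f (x0 + x1 + x2) + f x0 + f x1 + f x2); last by ring.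
  by congr (_ + _ + _ + _); apply: e; left; field.
- transitivity (f x0 + f (x0 - x1 - x2) + f x2 + f x1); last by ring.
  by congr (_ + _ + _ + _); apply: e; first [left; field|right; field].
- transitivity (f x1 + f x2 + f (- x0 + x1 - x2) + f x0); last by ring.
  by congr (_ + _ + _ + _); apply: e; first [left; field|right; field].
- transitivity (f x2 + f x1 + f x0 + f (- x0 - x1 + x2)); last by ring.
  by congr (_ + _ + _ + _); apply: e; first [left; field|right; field].
Qed.

Lemma sum4_distinct (A : nmodType) (k l : 'I_4) : k != l ->
  exists i j, [/\ i != k, i != l, j != k & j != l] /\
    forall h : 'I_4 -> A, \sum_v h v = h k + h l + h i + h j.
Proof.
move=> kl; have : #|~: [set k; l]%SET| == 2.
  have := cardsC [set k; l]%SET; rewrite cards2 kl card_ord => /eqP.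
  by rewrite -[4%N]/(2 + 2)%N eqn_add2l.
case/cards2P => i [j [ij S]].
have inS v : (v != k) && (v != l) = (v == i) || (v == j).
  have : (v \in ~: [set k; l]%SET) = (v \in [set i; j]%SET) by rewrite S.
  by rewrite !inE negb_or.
have /andP[ik il] : (i != k) && (i != l) by rewrite inS eqxx.
have /andP[jk jl] : (j != k) && (j != l) by rewrite inS eqxx orbT.
exists i, j; split=> // h.
rewrite (bigD1 k)//= (bigD1 l)/= 1?eq_sym// (bigD1 i)/= ?ik ?il// (bigD1 j)/= ?jk ?jl 1?eq_sym//.
rewrite big1 ?addr0 ?addrA// => v /andP[/andP[/andP[vk vl] vi] vj].
by have := inS v; rewrite vk vl (negbTE vi) (negbTE vj).
Qed.

(** Written with minima and maxima so that continuity is immediate: the second least value is the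
    larger of the two pair minima or the smaller of the two pair maxima. *)
Definition second_least (c : 'I_4 -> R) : R :=
  let c0 := c (inord 0) in let c1 := c (inord 1) in
  let c2 := c (inord 2) in let c3 := c (inord 3) in
  Num.min (Num.max (Num.min c0 c1) (Num.min c2 c3)) (Num.min (Num.max c0 c1) (Num.max c2 c3)).

Lemma second_leastP c : exists k l, [/\ k != l, c k <= c l, second_least c = c l &
  forall i, i != k -> c l <= c i].
Proof.
rewrite /second_least.
have ne (i j : nat) : (i < 4)%N -> (j < 4)%N -> i != j -> (inord i : 'I_4) != inord j.
  by move=> ? ?; apply: contra_neq => /(congr1 val); rewrite /= !inordK.
have all4 (P : 'I_4 -> Prop) : P (inord 0) -> P (inord 1) -> P (inord 2) -> P (inord 3) -> forall i, P i.
  move=> P0 P1 P2 P3 i; rewrite -(inord_val i); case: i => [[|[|[|[|]]]]]//.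
set c0 := c (inord 0); set c1 := c (inord 1); set c2 := c (inord 2); set c3 := c (inord 3).
have pk (k l : 'I_4) m : m = c l -> k != l -> c k <= c l ->
    (inord 0 != k -> c l <= c0) -> (inord 1 != k -> c l <= c1) ->
    (inord 2 != k -> c l <= c2) -> (inord 3 != k -> c l <= c3) ->
    exists k l, [/\ k != l, c k <= c l, m = c l & forall i, i != k -> c l <= c i].
  by move=> -> kl ckl h0 h1 h2 h3; exists k, l; split=> //; exact: all4.
pose o0 : 'I_4 := inord 0; pose o1 : 'I_4 := inord 1; pose o2 : 'I_4 := inord 2; pose o3 : 'I_4 := inord 3.
(* Each outcome of the comparisons fixes the least and second least indices; all ordered pairs are
   tried. *)
let at_ k l := solve [apply: (pk k l); [by []|..]; first [by [] | by rewrite eqxx | by apply: ne |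
  by rewrite -/c0 -/c1 -/c2 -/c3 => *; clear -h01 h23 h h' h''; lra]] in
case: (leP c0 c1) => h01; case: (leP c2 c3) => h23;
  [case: (leP c0 c2); case: (leP c1 c3)|case: (leP c0 c3); case: (leP c1 c2)|
   case: (leP c1 c2); case: (leP c0 c3)|case: (leP c1 c3); case: (leP c0 c2)] => h h';
  case: leP => h'';
  first [ at_ o0 o1 | at_ o0 o2 | at_ o0 o3
    | at_ o1 o0 | at_ o1 o2 | at_ o1 o3
    | at_ o2 o0 | at_ o2 o1 | at_ o2 o3
    | at_ o3 o0 | at_ o3 o1 | at_ o3 o2 ].
Qed.
End tetrahedral_coordinates.

Section real_functions.
Context {R : realType} {T : topologicalType}.
Implicit Types f g : T -> R.

Lemma continuous_add f g : continuous f -> continuous g -> continuous (fun x => f x + g x).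
Proof. by move=> cf cg x; exact: (@continuousD R R^o T f g x (cf x) (cg x)). Qed.

Lemma continuous_opp f : continuous f -> continuous (fun x => - f x).
Proof. by move=> cf x; exact: (@continuousN R R^o T f x (cf x)). Qed.

Lemma continuous_mulr f c : continuous f -> continuous (fun x => f x * c).
Proof. by move=> cf x; apply: cvgM; [exact: cf|exact: cvg_cst]. Qed.

Lemma continuous_minf f g : continuous f -> continuous g -> continuous (fun x => Num.min (f x) (g x)).
Proof. by move=> cf cg x; exact: (@continuous_min R T f g x (cf x) (cg x)). Qed.

Lemma continuous_maxf f g : continuous f -> continuous g -> continuous (fun x => Num.max (f x) (g x)).
Proof. by move=> cf cg x; exact: (@continuous_max R T f g x (cf x) (cg x)). Qed.

Lemma continuous_const (c : R) : continuous ((fun=> c) : T -> R).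
Proof. exact: cst_continuous. Qed.
End real_functions.
Arguments continuous_const {R T} c.
Arguments continuous_mulr {R T f} c.

(** * Embeddings of the ball in dimensions 3, 2 and 0 *)

Section upper_bounds.
Context {R : realType} {p : R} (p1 : 1 <= p).
Local Notation X := (set_type (lp_unit_ball p1 3)).
Local Notation pt x := (set_val x : 'rV[R]_3).

Let p0 : 0 < p. Proof. exact: lt_le_trans p1. Qed.

Lemma lp_le1 (x : X) : lp_norm p (pt x) <= 1.
Proof. exact: (set_valP x). Qed.

Lemma continuous_ball_coord i : continuous (fun x : X => pt x 0 i).
Proof.
move=> x A /nbhs_ballP[e /= e0 eA].
apply: (@filterS _ (nbhs x) _ (ball x e)); last exact: nbhsx_ballx.
move=> y; rewrite ballEmdist/= mdist_ball => xy; apply: eA; rewrite -ball_normE /=.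
apply: le_lt_trans xy; have -> : pt x 0 i - pt y 0 i = (pt x - pt y) 0 i.
  by rewrite mxE; congr (_ + _); rewrite mxE.
exact: coord_le_lp_norm.
Qed.

Lemma continuous_tetra v : continuous (fun x : X => tetra (pt x) v).
Proof.
have c := continuous_ball_coord.
rewrite /tetra; case: v => [[|[|[|[|]]]]//= _].
- exact: (continuous_add (continuous_add (c _) (c _)) (c _)).
- exact: (continuous_add (continuous_add (c _) (continuous_opp (c _))) (continuous_opp (c _))).
- exact: (continuous_add (continuous_add (continuous_opp (c _)) (c _)) (continuous_opp (c _))).
- exact: (continuous_add (continuous_add (continuous_opp (c _)) (continuous_opp (c _))) (c _)).
Qed.

Lemma tetra_le3 (x : X) v : `|tetra (pt x) v| <= 3.
Proof.
have c i : `|pt x 0 i| <= 1 by apply: le_trans (lp_le1 x); exact: coord_le_lp_norm.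
have := c (inord 0); have := c (inord 1); have := c (inord 2).
rewrite /tetra !ler_norml => /andP[? ?] /andP[? ?] /andP[? ?].
by apply/andP; case: v => [[|[|[|[|]]]]//= _]; split; lra.
Qed.

Lemma embedding_dim3 (eps : R) : 0 <= eps -> embeds_in_dimension eps X 3.
Proof.
move=> eps0.
(* As [|tetra| <= 3], division by 16 keeps the coordinates positive. *)
apply: (@skeleton_embedding 4 3 R X (fun x v => 4^-1 + tetra (pt x) v / 16)) => //.
- by move=> v; exact: (continuous_add (continuous_const 4^-1) (continuous_mulr (16^-1) (@continuous_tetra v))).
- move=> x; split=> [v||].
  + by have := tetra_le3 x v; rewrite ler_norml => /andP[? ?]; lra.
  + rewrite big_split/= -mulr_suml tetra_sum mul0r addr0 sumr_const card_ord.
    by rewrite -[LHS]mulr_natl divff.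
  + by apply: leq_trans (max_card _) _; rewrite card_ord.
- move=> x y xy; rewrite mdist_ball (_ : pt x - pt y = 0) ?lp_norm0//.
  by apply: tetra_inj => v; rewrite tetraB; have := xy v; lra.
Qed.

(* Coordinates of the projection, along the directions opposite to the vertices
   of the tetrahedron, of the ball onto the cone over its 1-skeleton. *)
Definition cone_coord (x : 'rV[R]_3) (v : 'I_4) : R :=
  Num.max 0 (tetra x v - second_least (tetra x)).

Lemma continuous_cone_coord v : continuous (fun x : X => cone_coord (pt x) v).
Proof.
have c := continuous_tetra.
exact: (continuous_maxf (continuous_const 0) (continuous_add (c v) (continuous_opp (continuous_minf
  (continuous_maxf (continuous_minf (c _) (c _)) (continuous_minf (c _) (c _)))
  (continuous_minf (continuous_maxf (c _) (c _)) (continuous_maxf (c _) (c _))))))).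
Qed.

(** The inner products of vertex [k] with the vertices are 3 at [k] and -1 elsewhere, so lowering
    coordinate [k] by [s], up to the common constant [m], is a slide by [s / 4] times that vertex.
    Two vanishing cone coordinates mean that the projected point lies on the cone over an edge. *)
Lemma cone_coordP (x : 'rV[R]_3) : lp_norm p x <= 1 -> exists m k l s,
  [/\ k != l, cone_coord x k = 0, cone_coord x l = 0, 0 <= s /\ 3 * (s / 4) `^ p <= 1 &
      forall v, tetra x v = m + cone_coord x v - (v == k)%:R * s].
Proof.
move=> x1; have [k [l [kl ckl El hl]]] := second_leastP (tetra x).
exists (tetra x l), k, l, (tetra x l - tetra x k).
have z t : t <= 0 -> Num.max 0 t = 0 :> R by move=> ?; rewrite max_l.
have dk : cone_coord x k = 0 by apply: z; rewrite El subr_le0.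
have dl : cone_coord x l = 0 by apply: z; rewrite El subrr.
split=> //; last first.
  move=> v; have [->|vk] := eqVneq v k; first by rewrite dk mul1r; ring.
  by rewrite /cone_coord El max_r ?subr_ge0 ?hl// mul0r; ring.
split; first by rewrite subr_ge0.
have [i [j [[ik il jk jl] sumE]]] := sum4_distinct R kl.
have s0 := tetra_sum x; rewrite sumE in s0.
apply: le_trans (least_gap_bound p1 s0 ckl (hl i ik) (hl j jk)) _.
have fN (t : R) : `|- t| `^ p = `|t| `^ p by rewrite normrN.
have := tetra_even_sum (f := fun t => `|t| `^ p) x k fN; rewrite sumE.
rewrite -lp_normK// (_ : (tetra x k + tetra x k) / 2 = tetra x k); last by field.
have : lp_norm p x `^ p <= 1.
  have <- : 1 `^ p = 1 :> R by rewrite powR1.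
  by rewrite ge0_ler_powR ?nnegrE ?lp_norm_ge0 ?(ltW p0).
by lra.
Qed.

(** Equal cone coordinates cancel in [x - y], which leaves only the slides along [k] and [k']. *)
Lemma cone_fibre (x y : 'rV[R]_3) : lp_norm p x <= 1 -> lp_norm p y <= 1 ->
  (forall v, cone_coord x v = cone_coord y v) ->
  lp_norm p (x - y) <= 2 * (2 / 3) `^ p^-1.
Proof.
move=> x1 y1 xy.
have [m [k [_ [s [_ _ _ [s0 s1] ex]]]]] := cone_coordP x1.
have [m' [k' [_ [s' [_ _ _ [s0' s1'] ey]]]]] := cone_coordP y1.
have norm_pow : lp_norm p (x - y) `^ p <= 2 `^ p * (2 / 3) -> lp_norm p (x - y) <= 2 * (2 / 3) `^ p^-1.
  move=> h; have h0 : 0 <= 2 `^ p * (2 / 3) :> R by rewrite mulr_ge0 ?powR_ge0.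
  have := @ge0_ler_powR _ p^-1 _ (lp_norm p (x - y) `^ p) (2 `^ p * (2 / 3)).
  rewrite !nnegrE invr_ge0 (ltW p0) powR_ge0 h0 => /(_ isT isT isT h).
  rewrite -powRrM mulfV ?gt_eqF// powRr1 ?lp_norm_ge0// powRM ?powR_ge0//.
  by rewrite -powRrM mulfV ?gt_eqF// powRr1.
apply: norm_pow.
pose e v := tetra (x - y) v.
have eE v : e v = (m - m') - (v == k)%:R * s + (v == k')%:R * s'.
  by rewrite /e tetraB ex ey xy; ring.
have es : \sum_v e v = 0 by exact: tetra_sum.
have fN (t : R) : `|- t| `^ p = `|t| `^ p by rewrite normrN.
have nE := tetra_even_sum (f := fun t => `|t| `^ p) (x - y) k fN; rewrite -lp_normK// -/(e k) in nE.
have a0 : 0 <= s / 4 by rewrite divr_ge0.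
have b0 : 0 <= s' / 4 by rewrite divr_ge0.
have two_p : 2 <= 2 `^ p :> R by rewrite -{1}(@powRr1 R 2) ?ler_powR// ler1n.
have ekk : (e k + e k) / 2 = e k by field.
(* On the same leg, every coordinate of [x - y] is [s / 4 - s' / 4] up to sign. *)
have [kk'|kk'] := eqVneq k k'.
  have [l kl] : exists l, k != l.
    have [->|k0] := eqVneq k ord0; [exists ord_max|exists ord0] => //.
  have [i [j [[ik il jk jl] sumE]]] := sum4_distinct R kl.
  have h v : v != k -> e v = m - m' by move=> /negbTE vk; rewrite eE -kk' vk !mul0r; ring.
  have ek : e k = m - m' - s + s' by rewrite eE -kk' eqxx !mul1r; ring.
  have lk : l != k by rewrite eq_sym.
  rewrite sumE (h l lk) (h i ik) (h j jk) ek in es.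
  have mm : m - m' = (s - s') / 4 by clear -es; lra.
  move: nE; rewrite sumE -!/(e _) ekk (h l lk) (h i ik) (h j jk).
  have -> : (e k + (m - m')) / 2 = - (s / 4 - s' / 4) by rewrite ek mm; field.
  rewrite fN => nE.
  have -> : lp_norm p (x - y) `^ p = 3 * `|s / 4 - s' / 4| `^ p by clear -nE; lra.
  have : `|s / 4 - s' / 4| `^ p <= (s / 4) `^ p \/ `|s / 4 - s' / 4| `^ p <= (s' / 4) `^ p.
    have [ab|ab] := leP (s / 4) (s' / 4); [right|left].
      rewrite ge0_ler_powR ?nnegrE ?(ltW p0)// ler0_norm ?subr_le0//; clear -a0; lra.
    rewrite ge0_ler_powR ?nnegrE ?(ltW p0)// ger0_norm ?subr_ge0 ?(ltW ab)//; clear -b0; lra.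
  by clear -s1 s1' two_p; case; lra.
(* On different legs, one coordinate is [s / 4 - s' / 4] and the other two are [s / 4 + s' / 4], up
   to sign. *)
have [i [j [[ik ik' jk jk'] sumE]]] := sum4_distinct R kk'.
have h v : v != k -> v != k' -> e v = m - m'.
  by move=> /negbTE vk /negbTE vk'; rewrite eE vk vk' !mul0r; ring.
have ek : e k = m - m' - s by rewrite eE eqxx (negbTE kk') mul1r mul0r; ring.
have ek' : e k' = m - m' + s' by rewrite eE eqxx eq_sym (negbTE kk') mul1r mul0r; ring.
rewrite sumE (h i ik ik') (h j jk jk') ek ek' in es.
have mm : m - m' = (s - s') / 4 by clear -es; lra.
move: nE; rewrite sumE -!/(e _) ekk (h i ik ik') (h j jk jk').
have -> : (e k + e k') / 2 = - (s / 4 - s' / 4) by rewrite ek ek' mm; field.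
have -> : (e k + (m - m')) / 2 = - (s / 4 + s' / 4) by rewrite ek mm; field.
rewrite !fN (@ger0_norm _ (s / 4 + s' / 4)) ?addr_ge0// => nE.
apply: le_trans (two_gap_bound p1 a0 b0 s1 s1'); clear -nE; lra.
Qed.

Lemma embedding_dim2 (eps : R) : 2 * (2 / 3) `^ p^-1 <= eps -> embeds_in_dimension eps X 2.
Proof.
move=> eps0.
(* Cone coordinates on the ball are at most 6, so the four quotients sum to at most 1. *)
pose d (x : X) v := cone_coord (pt x) v / 24.
(* The fifth vertex is the apex of the cone and takes the remaining weight. *)
pose g x (v : 'I_5) := if unlift ord_max v is Some w then d x w else 1 - \sum_w d x w.
have d_ge0 x w : 0 <= d x w by rewrite divr_ge0// le_max lexx.
have g_lift x w : g x (lift ord_max w) = d x w by rewrite /g liftK.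
have g_max x : g x ord_max = 1 - \sum_w d x w by rewrite /g unlift_none.
have cd w : continuous (d ^~ w).
  exact: (continuous_mulr (24^-1) (@continuous_cone_coord w)).
apply: (@skeleton_embedding 5 2 R X g) => //.
- move=> v; case: (unliftP ord_max v) => [w|] ->.
    by rewrite (_ : g^~ _ = d ^~ w)//; apply/funext => x.
  rewrite (_ : g^~ _ = fun x => 1 - (d x (inord 0) + d x (inord 1) + d x (inord 2) + d x (inord 3))); last first.
    by apply/funext => x; rewrite g_max sum4.
  exact: (continuous_add (continuous_const 1) (continuous_opp (continuous_add (continuous_add (continuous_add (cd _) (cd _)) (cd _)) (cd _)))).
- move=> x; have [m [k [l [s [kl dk dl _ tE]]]]] := cone_coordP (lp_le1 x).
  split=> [v||].
  + case: (unliftP ord_max v) => [w|] ->; first by rewrite g_lift.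
    have d1 w : d x w <= 4^-1.
      have [k' [l' [_ _ El _]]] := second_leastP (tetra (pt x)).
      rewrite /d /cone_coord El; have := tetra_le3 x w; have := tetra_le3 x l'.
      rewrite !ler_norml => /andP[? ?] /andP[? ?].
      by rewrite ler_pdivrMr// ge_max; apply/andP; split; lra.
    rewrite g_max subr_ge0; apply: le_trans (ler_sum _ (fun w _ => d1 w)) _.
    by rewrite sumr_const card_ord -[leLHS]mulr_natl divff.
  + rewrite (bigD1_ord ord_max)//= g_max.
    by under eq_bigr do rewrite g_lift; rewrite subrK.
  + have dz w : cone_coord (pt x) w = 0 -> g x (lift ord_max w) = 0.
      by move=> h; rewrite g_lift /d h mul0r.
    have sub : [set v | g x v != 0%R]%SET \subset ~: [set lift ord_max k; lift ord_max l]%SET.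
      apply/fintype.subsetP => v; rewrite !inE; apply: contraNN.
      by case/orP => /eqP ->; rewrite dz.
    apply: leq_trans (subset_leq_card sub) _.
    have := cardsC [set lift ord_max k; lift ord_max l]%SET.
    by rewrite cards2 (inj_eq lift_inj) kl card_ord /= -[5%N]/(2 + 3)%N => /eqP; rewrite eqn_add2l => /eqP ->.
- move=> x y xy; rewrite mdist_ball; apply: le_trans eps0.
  apply: cone_fibre; [exact: lp_le1|exact: lp_le1|move=> v].
  by have := xy (lift ord_max v); rewrite !g_lift /d => /divIf; apply; rewrite pnatr_eq0.
Qed.

Lemma embedding_dim0 (eps : R) : 2 <= eps -> embeds_in_dimension eps X 0.
Proof.
move=> eps2; apply: (@skeleton_embedding 1 0 R X (fun _ _ => 1)) => //.
- by move=> v; exact: cst_continuous.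
- by move=> x; split=> //; [rewrite big_ord1|apply: leq_trans (max_card _) _; rewrite card_ord].
- move=> x y _; rewrite mdist_ball; apply: le_trans eps2; apply: le_trans (ler_lp_normD p1 _ _) _.
  by rewrite lp_normN (_ : 2 = 1 + 1)// lerD// lp_le1.
Qed.
End upper_bounds.

Theorem corollary3p17 (R : realType) (p : R) (p1 : 1 <= p) (p2 : p <= 2)
    (eps : R) (eps_gt0 : 0 < eps) :
  [/\ 2 <= eps -> is_wdim eps (set_type (lp_unit_ball p1 3)) 0,
      2 * (2 / 3) `^ p^-1 <= eps < 2 -> is_wdim eps (set_type (lp_unit_ball p1 3)) 2 &
      eps < 2 * (2 / 3) `^ p^-1 -> is_wdim eps (set_type (lp_unit_ball p1 3)) 3].
Proof.
split=> [eps2|/andP[eps_ge eps2]|eps_lt]; split.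
- exact: embedding_dim0.
- by [].
- exact: embedding_dim2.
- by move=> j; apply: contraPT; rewrite -ltnNge ltnS => /(no_embedding_dim1 eps2).
- exact/embedding_dim3/ltW.
- by move=> j; apply: contraPT; rewrite -ltnNge ltnS => /(no_embedding_dim2 p2 eps_lt).
Qed.
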